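(* Given $\omega,\tilde\omega\in\mathbb{R}^{\mathbb{N}}$, let $(\mathbb{T}^{\mathbb{N}},\Phi_\omega)$ and $(\mathbb{T}^{\mathbb{N}},\Phi_{\tilde\omega})$ be the two associated Kronecker flows on the infinite torus. The closure of any orbit of $\Phi_\omega$ is homeomorphic to the closure of any orbit of $\Phi_{\tilde\omega}$ if and only if the associated frequency modules $\mathscr{M}_\omega$ and $\mathscr{M}_{\tilde\omega}$ are isomorphic as abelian groups.
   Context: $\mathbb{N}=\{1,2,\dots\}$, $\mathbb{T}=\mathbb{R}/2\pi\mathbb{Z}$, and $\mathbb{T}^{\mathbb{N}}$ carries the product topology. For $\omega=(\omega_j)_{j\in\mathbb{N}}\in\mathbb{R}^{\mathbb{N}}$ the Kronecker flow is $\Phi_\omega^t(\theta)=(\Theta_j+\omega_jt+2\pi\mathbb{Z})_{j\in\mathbb{N}}$, where $\theta_j=\Theta_j+2\pi\mathbb{Z}$. All orbit closures of a given Kronecker flow are translates of one another, hence mutually homeomorphic. $\mathbb{Z}^{(\mathbb{N})}$ is the group of finitely supported integer sequences, and the frequency module is the additive subgroup $\mathscr{M}_\omega=\{\sum_j\omega_j\nu_j:\nu\in\mathbb{Z}^{(\mathbb{N})}\}$ of $\mathbb{R}$. *)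

(* Defs.v *)
From HB Require Import structures.
From mathcomp Require Import all_boot all_order all_algebra finmap generic_quotient.
From mathcomp Require Import all_classical all_reals all_analysis.
Set Implicit Arguments.
Unset Strict Implicit.
Unset Printing Implicit Defensive.
Import Order.TTheory GRing.Theory Num.Theory.
Import numFieldNormedType.Exports.

Local Open Scope classical_set_scope.
Local Open Scope quotient_scope.
Local Open Scope ring_scope.

(* Sequences indexed by {1, 2, ...} are encoded as functions on [nat]: the
   value at [j : nat] is the term of index [j + 1]. *)

Section Torus.
Variable R : realType.

Definition eqmod2pi (x y : R) : bool :=
  `[< exists k : int, x - y = k%:~R * (2 * pi) >].

Lemma eqmod2pi_refl : reflexive eqmod2pi.
Proof. by move=> x; apply/asboolP; exists 0; rewrite subrr mul0r. Qed.

Lemma eqmod2pi_sym : symmetric eqmod2pi.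
Proof.
suff H x y : eqmod2pi x y -> eqmod2pi y x by move=> x y; apply/idP/idP => /H.
move=> /asboolP[k kE]; apply/asboolP; exists (- k).
by rewrite mulrNz mulNr -kE opprB.
Qed.

Lemma eqmod2pi_trans : transitive eqmod2pi.
Proof.
move=> y x z /asboolP[k kE] /asboolP[l lE]; apply/asboolP; exists (k + l).
by rewrite intrD mulrDl -kE -lE addrA subrK.
Qed.

Canonical eqmod2pi_equiv :=
  EquivRel eqmod2pi eqmod2pi_refl eqmod2pi_sym eqmod2pi_trans.

Definition torus : topologicalType :=
  quotient_topology {eq_quot eqmod2pi_equiv}.

Definition to_torus (x : R) : torus :=
  \pi_({eq_quot eqmod2pi_equiv}) x.

Definition inf_torus : topologicalType := {ptws nat -> torus}.

Definition torus_lift (p : torus) : R :=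
  repr (p : {eq_quot eqmod2pi_equiv}).

Definition kronecker_flow (w : nat -> R) (t : R) (theta : inf_torus) :
    inf_torus :=
  fun j => to_torus (torus_lift (theta j) + w j * t).

Lemma to_torusP (x y : R) :
  to_torus x = to_torus y <-> exists k : int, x - y = k%:~R * (2 * pi).
Proof.
split=> [/eqmodP/asboolP//|xy].
by apply/eqmodP/asboolP.
Qed.

(* The flow does not depend on the choice of the lift. *)
Lemma kronecker_flowE (w : nat -> R) (t : R) (Theta : nat -> R) :
  kronecker_flow w t (fun j => to_torus (Theta j)) =
  (fun j => to_torus (Theta j + w j * t)).
Proof.
apply/funext => j; apply/to_torusP.
have /to_torusP[k kE] : to_torus (torus_lift (to_torus (Theta j))) =
  to_torus (Theta j) by exact: reprK.
by exists k; rewrite -kE opprD addrACA subrr addr0.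
Qed.

Definition kronecker_orbit (w : nat -> R) (theta : inf_torus) :
    set inf_torus :=
  [set kronecker_flow w t theta | t in [set: R]].

Definition freq_sum (w : nat -> R) (nu : {fsfun nat -> int with 0}) : R :=
  \sum_(j <- finsupp nu) w j * (nu j)%:~R.

Definition freq_module (w : nat -> R) : {pred R} :=
  mem [set x | exists nu, x = freq_sum w nu].

Lemma freq_sum_widen (w : nat -> R) (nu : {fsfun nat -> int with 0})
    (A : {fset nat}) :
  (finsupp nu `<=` A)%fset ->
  freq_sum w nu = \sum_(j <- A) w j * (nu j)%:~R.
Proof.
move=> suppA; apply: big_fset_incl => // j _ /fsfun_dflt ->.
by rewrite mulr0z mulr0.
Qed.

Lemma freq_module_zmod_closed (w : nat -> R) : zmod_closed (freq_module w).
Proof.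
split=> [|x y].
  rewrite inE; exists [fsfun]; rewrite /freq_sum big1// => j _.
  by rewrite fsfun0E mulr0z mulr0.
rewrite !inE => -[a ->] [b ->].
pose A := (finsupp a `|` finsupp b)%fset.
pose c : {fsfun nat -> int with 0} := [fsfun j in A => a j - b j].
have cE j : c j = a j - b j.
  rewrite fsfunE; case: ifPn => //; rewrite in_fsetU negb_or => /andP[aj bj].
  by rewrite !fsfun_dflt// subrr.
exists c; rewrite (freq_sum_widen w (fsubsetUl _ (finsupp b))).
rewrite (freq_sum_widen w (fsubsetUr (finsupp a) _)) (@freq_sum_widen w c A).
  by rewrite -sumrB; apply: eq_bigr => j _; rewrite cE intrB mulrBr.
by apply/fsubsetP => j; rewrite mem_finsupp fsfunE; case: ifPn => //; rewrite eqxx.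
Qed.

HB.instance Definition _ (w : nat -> R) :=
  GRing.isZmodClosed.Build R (freq_module w) (freq_module_zmod_closed w).

Definition freq_group (w : nat -> R) := {x : R | x \in freq_module w}.

HB.instance Definition _ (w : nat -> R) := SubChoice.on (freq_group w).
HB.instance Definition _ (w : nat -> R) :=
  [SubChoice_isSubZmodule of freq_group w by <:].

End Torus.

Definition homeomorphic (X Y : topologicalType) : Prop :=
  exists (f : X -> Y) (g : Y -> X),
    [/\ continuous f, continuous g, cancel f g & cancel g f].

Definition zmod_isomorphic (U V : zmodType) : Prop :=
  exists f : {additive U -> V}, bijective f.

(* Main.v *)
Require Import Defs.
From HB Require Import structures.
From mathcomp Require Import all_boot all_order all_algebra finmap.
From mathcomp Require Import all_classical all_reals all_analysis.
From mathcomp Require Import ring lra zify.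
Set Implicit Arguments.
Unset Strict Implicit.
Unset Printing Implicit Defensive.

(** Let X be the closure of the orbit of the origin under the flow of w.  The
    theorem says that X, as a mere topological space, carries the same
    information as the abelian group M = freq_module w.  The reason is that X
    is a compact group whose Pontryagin dual is M.

    The duality is Kronecker's approximation theorem: a point x belongs to X
    as soon as every integral linear form L with L(w) = 0 satisfies
    L(x) = 0 mod 2 pi ([kronecker], [closure_orbitP]).  Given finitely many
    coordinates, the proof concentrates a nonnegative trigonometric polynomial
    near the target; its mean along the flow, which is at least its constant
    coefficient, would be too small if the flow avoided the target.

    From modules to closures: an isomorphism between two modules and its
    inverse are given on the generators by integral linear forms, and
    substituting these forms for the coordinates carries one family of
    relations to the other ([iso_homeomorphic]).

    From closures to modules: M is recovered as the group of continuous maps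
    from X to the circle modulo those that lift to real-valued continuous
    functions, that is, as the first cohomology group of X.  This needs two
    facts.  Every continuous map from X to the circle is the product of a
    character and of a map that lifts ([hull_character]), and a character that
    lifts has frequency 0 ([hull_character_unique]).  A homeomorphism preserves
    the maps that lift, so it matches the characters of both closures up to
    such maps, and this matching is an isomorphism ([homeomorphic_iso]).

    The first fact is Bohr's theorem on the argument of an almost periodic
    function ([bohr_argument]).  Along the orbit, the map lifts to a real
    function psi.  If tau lies in a small Bohr set, that is, if finitely many
    w_j tau are close to 0 mod 2 pi, then psi (t + tau) - psi t is close to a
    multiple of 2 pi that does not depend on t.  Compactness of X makes the Bohr
    sets relatively dense, so psi is additive up to a bounded error, hence
    equal to lam t up to a bounded error.  An error that is bounded cannot
    accumulate, so lam tau is itself close to 0 mod 2 pi for tau in a Bohr set,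
    and Kronecker's theorem forces lam into M.  The same estimate shows that
    psi t - lam t is uniformly continuous for the topology that the orbit
    inherits from X, and so extends to X.

    Circle-valued maps are handled throughout as real functions continuous
    modulo 2 pi ([contmod]), and elements of M through integral linear forms
    ([intform]) evaluated at w, so that no group structure on the torus and no
    manipulation of indices is required. *)

Import Order.TTheory GRing.Theory Num.Theory.
Import numFieldNormedType.Exports.
Local Open Scope classical_set_scope.
Local Open Scope ring_scope.

(** * Integral linear forms *)

(** An inductive presentation of the finitely supported integer combinations
    of coordinates: closure under composition, and compatibility with
    continuity or with group morphisms, become structural inductions. *)
Inductive intform (R : realType) : ((nat -> R) -> R) -> Prop :=
| intform_coord j : intform (fun z => z j)
| intform0 : intform (fun=> 0)
| intformD L M : intform L -> intform M -> intform (fun z => L z + M z)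
| intformN L : intform L -> intform (fun z => - L z).

Lemma intformB (R : realType) (L M : (nat -> R) -> R) :
  intform L -> intform M -> intform (fun z => L z - M z).
Proof. by move=> fL fM; apply: intformD => //; apply: intformN. Qed.

Lemma intformMz (R : realType) (L : (nat -> R) -> R) (k : int) :
  intform L -> intform (fun z => L z *~ k).
Proof.
move=> fL; have natcase n : intform (fun z => L z *~ Posz n).
  elim: n => [|n ihn].
    by rewrite (_ : (fun _ => _) = fun=> 0); [exact: intform0|apply/funext].
  rewrite (_ : (fun _ => _) = fun z => L z + L z *~ Posz n).
    exact: intformD.
  by apply/funext => z; rewrite -!pmulrn mulrS.
case: k => n; first exact: natcase.
rewrite (_ : (fun _ => _) = fun z => - (L z *~ Posz n.+1)).
  exact: intformN.
by apply/funext => z; rewrite NegzE mulrNz.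
Qed.

Lemma intform_linear (R : realType) (L : (nat -> R) -> R) (a b : R)
    (y z : nat -> R) : intform L ->
  L (fun j => a * y j + b * z j) = a * L y + b * L z.
Proof.
elim=> [j //||M N _ + _ +|M _ +]; first by rewrite !mulr0 addr0.
  by move=> -> ->; ring.
by move=> ->; ring.
Qed.

Lemma intformZ (R : realType) (L : (nat -> R) -> R) (a : R) (z : nat -> R) :
  intform L -> L (fun j => a * z j) = a * L z.
Proof.
move=> fL; rewrite -[RHS]addr0 -(mul0r (L z)) -intform_linear //.
by congr L; apply/funext => j; rewrite mul0r addr0.
Qed.

Lemma intformBE (R : realType) (L : (nat -> R) -> R) (y z : nat -> R) :
  intform L -> L (fun j => y j - z j) = L y - L z.
Proof.
move=> fL; have := intform_linear 1 (-1) y z fL; rewrite mul1r mulN1r => <-.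
by congr L; apply/funext => j; rewrite mul1r mulN1r.
Qed.

Lemma intform_comp (R : realType) (L : (nat -> R) -> R)
    (B : nat -> (nat -> R) -> R) :
  intform L -> (forall i, intform (B i)) -> intform (fun z => L (B ^~ z)).
Proof.
move=> fL fB; elim: fL => {L} [j|| L M _ + _ +|L _ +] //.
- exact: intform0.
- exact: intformD.
- exact: intformN.
Qed.

(** Isolates the coefficient of the first coordinate, in order to treat a
    sequence of frequencies to which a new one has been prepended. *)
Lemma intform_split_head (R : realType) (L : (nat -> R) -> R) :
  intform L -> exists (a : int) (M : (nat -> R) -> R), intform M /\
    forall z, L z = z 0%N *~ a + M (fun j => z j.+1).
Proof.
elim=> [[|j]||L1 L2 _ [a [M [fM ME]]] _ [b [N [fN NE]]]|L1 _ [a [M [fM ME]]]].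
- by exists 1, (fun=> 0); split=> [|z]; [exact: intform0|rewrite mulr1z addr0].
- exists 0, (fun z => z j); split=> [|z]; first exact: intform_coord.
  by rewrite mulr0z add0r.
- by exists 0, (fun=> 0); split=> [|z]; [exact: intform0|rewrite mulr0z addr0].
- exists (a + b), (fun z => M z + N z); split=> [|z]; first exact: intformD.
  by rewrite ME NE mulrzDr; ring.
exists (- a), (fun z => - M z); split=> [|z]; first exact: intformN.
by rewrite ME mulrNz opprD.
Qed.

Lemma freq_moduleP (R : realType) (w : nat -> R) (x : R) :
  x \in freq_module w <-> exists2 L, intform L & x = L w.
Proof.
split=> [|[L fL ->]].
  rewrite inE => -[nu ->]; rewrite /freq_sum.
  elim: (finsupp nu : seq nat) => [|j s [L fL ihs]].
    by exists (fun=> 0); [exact: intform0|rewrite big_nil].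
  exists (fun z => z j *~ nu j + L z).
    exact/intformD/fL/intformMz/intform_coord.
  by rewrite big_cons ihs mulrzr.
elim: fL => [j||M N _ Mw _ Nw|M _ Mw].
- rewrite inE; pose nu : {fsfun nat -> int with 0} := [fsfun i in [fset j]%fset => 1].
  exists nu; rewrite (@freq_sum_widen _ _ _ [fset j]%fset).
    by rewrite big_seq_fset1 fsfunE inE eqxx mulr1.
  by apply/fsubsetP => i; rewrite mem_finsupp fsfunE; case: ifPn => //; rewrite eqxx.
- exact: rpred0.
- exact: rpredD.
- by rewrite rpredN.
Qed.

(** * Real numbers modulo 2 pi *)

Definition int2pi (R : realType) (z : R) : Prop :=
  exists k : int, z = k%:~R * (2 * pi).

Lemma int2pi0 (R : realType) : int2pi (0 : R).
Proof. by exists 0; rewrite mul0r. Qed.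

Lemma int2piD (R : realType) (y z : R) : int2pi y -> int2pi z -> int2pi (y + z).
Proof. by move=> [k ->] [l ->]; exists (k + l); rewrite intrD [RHS]mulrDl. Qed.

Lemma int2piN (R : realType) (z : R) : int2pi z -> int2pi (- z).
Proof. by move=> [k ->]; exists (- k); rewrite mulrNz mulNr. Qed.

Lemma int2piB (R : realType) (y z : R) : int2pi y -> int2pi z -> int2pi (y - z).
Proof. by move=> ? /int2piN; exact: int2piD. Qed.

Lemma int2pi_intform (R : realType) (L : (nat -> R) -> R) (z : nat -> R) :
  intform L -> (forall j, int2pi (z j)) -> int2pi (L z).
Proof.
move=> fL iz; elim: fL => // [|M N _ ? _ ?|M _ ?].
- exact: int2pi0.
- exact: int2piD.
- exact: int2piN.
Qed.

Lemma cosD2pi_int (R : realType) (x : R) (k : int) :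
  cos (x + k%:~R * (2 * pi)) = cos x.
Proof.
have natcase (y : R) n : cos (y + n%:R * (2 * pi)) = cos y.
  elim: n => [|n ihn]; first by rewrite mul0r addr0.
  rewrite -natr1 mulrDl mul1r addrA -[RHS]ihn.
  by rewrite -[RHS]cosD2pi mulr2n mulrDl !mul1r.
case: k => n; first exact: natcase.
by rewrite NegzE mulrNz mulNr -[LHS](natcase _ n.+1) -pmulrn subrK.
Qed.

Definition near2pi (R : realType) (e z : R) : Prop :=
  exists k : int, `|z - k%:~R * (2 * pi)| < e.

Lemma exists_norm_le_pi (R : realType) (z : R) :
  exists k : int, `|z - k%:~R * (2 * pi)| <= pi.
Proof.
have pi0 : 0 < 2 * pi :> R by rewrite mulr_gt0 ?pi_gt0.
pose k := Num.floor (z / (2 * pi) + 2^-1); exists k.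
have := Num.Theory.floor_le (z / (2 * pi) + 2^-1).
have := floorD1_gt (z / (2 * pi) + 2^-1).
rewrite -/k intrD mulr1z => lo hi.
have zE : z / (2 * pi) * (2 * pi) = z by rewrite divfK // gt_eqF.
rewrite ler_norml; apply/andP; split.
  have : k%:~R * (2 * pi) <= (z / (2 * pi) + 2^-1) * (2 * pi) by rewrite ler_pM2r.
  by rewrite [(_ + 2^-1) * _]mulrDl zE; lra.
have : (z / (2 * pi) + 2^-1) * (2 * pi) < (k%:~R + 1) * (2 * pi) by rewrite ltr_pM2r.
by rewrite [(_ + 2^-1) * _]mulrDl zE mulrDl; lra.
Qed.

Lemma cos_le_of_not_near2pi (R : realType) (e z : R) :
  0 <= e <= pi -> ~ near2pi e z -> cos z <= cos e.
Proof.
move=> /andP[e0 epi] nz; have [k zk] := exists_norm_le_pi z.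
have ez : e <= `|z - k%:~R * (2 * pi)|.
  by rewrite leNgt; apply/negP => ?; apply: nz; exists k.
rewrite -[z](subrK (k%:~R * (2 * pi))) cosD2pi_int -cos_norm.
rewrite leNgt; apply/negP; rewrite ltr_cos; first by lra.
  by rewrite in_itv /= ?e0 ?normr_ge0.
by rewrite in_itv /= ?e0 ?normr_ge0.
Qed.

Lemma near2pi_norm (R : realType) (e z : R) : `|z| < e -> near2pi e z.
Proof. by exists 0; rewrite mul0r subr0. Qed.

Lemma near2piD (R : realType) (d e y z : R) :
  near2pi d y -> near2pi e z -> near2pi (d + e) (y + z).
Proof.
move=> [k ke] [l le]; exists (k + l).
rewrite intrD [_ * (2 * pi)]mulrDl opprD addrACA; apply: le_lt_trans (ler_normD _ _) _.
exact: ltrD.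
Qed.

Lemma near2piN (R : realType) (e z : R) : near2pi e z -> near2pi e (- z).
Proof. by move=> [k ke]; exists (- k); rewrite mulrNz mulNr -opprD normrN. Qed.

Lemma near2piW (R : realType) (d e z : R) : d <= e -> near2pi d z -> near2pi e z.
Proof. by move=> de [k ke]; exists k; exact: lt_le_trans ke de. Qed.

Lemma near2pi_int2pi (R : realType) (e y z : R) :
  int2pi (y - z) -> near2pi e y -> near2pi e z.
Proof.
move=> [l lE] [k ke]; exists (k - l).
suff -> : z - (k - l)%:~R * (2 * pi) = y - k%:~R * (2 * pi) by [].
by rewrite intrB [_ * (2 * pi)]mulrBl -lE; ring.
Qed.

Lemma near2pi_sub_trans (R : realType) (d e x y z : R) :
  near2pi d (x - y) -> near2pi e (y - z) -> near2pi (d + e) (x - z).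
Proof. by move=> xy yz; have := near2piD xy yz; rewrite addrA subrK. Qed.

Lemma near2pi_sub_sym (R : realType) (e x y : R) :
  near2pi e (x - y) -> near2pi e (y - x).
Proof. by move=> /near2piN; rewrite opprB. Qed.

Lemma near2pi_repr (R : realType) (e z : R) :
  near2pi e z -> exists2 y, int2pi (y - z) & `|y| < e.
Proof.
move=> [k ke]; exists (z - k%:~R * (2 * pi)) => //.
by exists (- k); rewrite mulrNz mulNr; ring.
Qed.

(** The multiples of 2 pi are 2 pi apart: a number close to one of them can
    only be close to 0 when it is not too large.  This turns estimates modulo
    2 pi into estimates on real numbers. *)
Lemma near2pi_norm_lt (R : realType) (e z : R) :
  near2pi e z -> `|z| <= 2 * pi - e -> `|z| < e.
Proof.
move=> [k ke] zs; suff k0 : k = 0 by rewrite k0 mul0r subr0 in ke.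
have pi0 := pi_gt0 R; apply/eqP; rewrite -normr_le0 -ltzD1 add0r.
rewrite -(ltr_int R) intr_norm -(ltr_pM2r (_ : 0 < 2 * pi :> R)) ?mulr_gt0 //.
rewrite mul1r -[X in _ * X]gtr0_norm ?mulr_gt0 // -normrM.
have -> : k%:~R * (2 * pi) = z - (z - k%:~R * (2 * pi)) :> R by ring.
apply: le_lt_trans (ler_normB _ _) _; lra.
Qed.

Lemma int2pi_eq0 (R : realType) (z : R) : int2pi z -> `|z| < 2 * pi -> z = 0.
Proof.
move=> [k kE] zs; apply/eqP; rewrite -normr_le0 leNgt; apply/negP => z0.
pose e := Num.min `|z| (2 * pi - `|z|).
have e0 : 0 < e by rewrite lt_min z0 subr_gt0.
have : `|z| < e.
  apply: near2pi_norm_lt; first by exists k; rewrite kE subrr normr0.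
  have : e <= 2 * pi - `|z| by rewrite ge_min lexx orbT.
  lra.
by rewrite lt_min ltxx.
Qed.

Lemma near2pi_all_int2pi (R : realType) (z : R) :
  (forall e, 0 < e -> near2pi e z) -> int2pi z.
Proof.
move=> nz; have [k ke] := exists_norm_le_pi z.
pose y := z - k%:~R * (2 * pi); have pi0 := pi_gt0 R.
suff y0 : y = 0 by exists k; apply/eqP; rewrite -subr_eq0 -/y y0.
have ny e : 0 < e -> near2pi e y.
  move=> e0; apply: near2pi_int2pi (nz _ e0); exists k; rewrite /y; ring.
apply/eqP; rewrite -normr_le0 leNgt; apply/negP => y0.
suff /(near2pi_norm_lt (ny _ y0)) : `|y| <= 2 * pi - `|y| by rewrite ltxx.
by move: ke; rewrite -/y; lra.
Qed.

(** * Means of trigonometric polynomials on the line *)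

(** The index n counts the terms and c is the mean, the coefficient of
    frequency 0; the frequencies mu may repeat. *)
Inductive trigsum (R : realType) : nat -> R -> (R -> R) -> Prop :=
| trigsum_const c : trigsum 0 c (fun=> c)
| trigsum_term n c g a b mu : mu != 0 -> trigsum n c g ->
    trigsum n.+1 c (fun t => g t + (a * cos (mu * t) + b * sin (mu * t))).

(** Averaging a sum with one of its translates changes the amplitudes but
    neither the frequencies nor the mean. *)
Lemma trigsum_average (R : realType) n (c : R) g s :
  trigsum n c g -> trigsum n c (fun t => (g t + g (t + s)) / 2).
Proof.
elim=> [{}c|{}n {}c {}g a b mu mu0 _ ih].
  by rewrite (_ : (fun _ => _) = fun=> c); [constructor|apply/funext => t; field].
set f := (X in trigsum _ _ X).
rewrite (_ : f = fun t => (g t + g (t + s)) / 2 +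
  ((a + a * cos (mu * s) + b * sin (mu * s)) / 2 * cos (mu * t) +
   (b + b * cos (mu * s) - a * sin (mu * s)) / 2 * sin (mu * t))).
  by constructor.
by apply/funext => t; rewrite /f mulrDr cosD sinD; field.
Qed.

Lemma trigsumDr (R : realType) n (c a : R) g :
  trigsum n c g -> trigsum n (c + a) (fun t => g t + a).
Proof.
elim=> [{}c|{}n {}c {}g b b' mu mu0 _ ih]; first by constructor.
rewrite (_ : (fun _ => _) = fun t => g t + a +
  (b * cos (mu * t) + b' * sin (mu * t))); first by constructor.
by apply/funext => t; rewrite addrAC.
Qed.

(** Instead of integrating, one averages g (t) and g (t + pi / mu): this kills
    the terms of frequency mu, keeps the bound and the mean, and leaves the
    other frequencies unchanged, so finitely many averages leave only c. *)
Lemma trigsum_mean_le (R : realType) n (c : R) g (B : R) :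
  trigsum n c g -> (forall t, g t <= B) -> c <= B.
Proof.
elim: n c g => [|n ih] c g.
  move Em : 0%N => m tg; case: tg Em => // c' _ /(_ 0) //.
move Em : n.+1 => m tg; case: tg Em => // m' {}c {}g a b mu mu0 tg [nm] gB.
rewrite -nm in tg; apply: ih (trigsum_average (pi / mu) tg) _ => t.
have := gB t; have := gB (t + pi / mu).
rewrite mulrDr [mu * (pi / mu)]mulrC divfK // cosDpi sinDpi.
lra.
Qed.

(** * Trigonometric polynomials with nonnegative coefficients *)

(** Cosine polynomials in infinitely many angles with nonnegative coefficients.
    The index c is only a lower bound for the constant coefficient, because
    the form L = 0 is allowed in the cosine terms. *)
Inductive posdef (R : realType) : R -> ((nat -> R) -> R) -> Prop :=
| posdef_const c : 0 <= c -> posdef c (fun=> c)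
| posdef_cos c g a L : posdef c g -> 0 <= a -> intform L ->
    posdef c (fun y => g y + a * cos (L y)).

Lemma posdefD (R : realType) (c d : R) g h :
  posdef c g -> posdef d h -> posdef (c + d) (fun y => g y + h y).
Proof.
move=> pg; elim=> [{}d d0|{}d {}h a L _ ih a0 fL].
  elim: pg => [{}c c0|{}c {}g a L _ ih a0 fL].
    by apply: posdef_const; exact: addr_ge0.
  rewrite (_ : (fun _ => _) = fun y => g y + d + a * cos (L y)).
    exact: posdef_cos.
  by apply/funext => y; rewrite addrAC.
rewrite (_ : (fun _ => _) = fun y => g y + h y + a * cos (L y)).
  exact: posdef_cos.
by apply/funext => y; rewrite addrA.
Qed.

Lemma posdefZ (R : realType) (c k : R) g :
  0 <= k -> posdef c g -> posdef (k * c) (fun y => k * g y).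
Proof.
move=> k0; elim=> [{}c c0|{}c {}g a L _ ih a0 fL].
  by apply: posdef_const; exact: mulr_ge0.
rewrite (_ : (fun _ => _) = fun y => k * g y + k * a * cos (L y)).
  by apply: posdef_cos => //; exact: mulr_ge0.
by apply/funext => y; rewrite mulrDr mulrA.
Qed.

(** The product of two cosines is the half-sum of the cosines of the sum and
    of the difference, so nonnegativity of the coefficients is preserved. *)
Lemma posdefMcos (R : realType) (c a : R) g L :
  posdef c g -> 0 <= a -> intform L -> posdef 0 (fun y => g y * (a * cos (L y))).
Proof.
move=> pg a0 fL; elim: pg => [{}c c0|{}c {}g b M _ ih b0 fM].
  rewrite (_ : (fun _ => _) = fun y => 0 + c * a * cos (L y)).
    by apply: posdef_cos => //; [exact: posdef_const|exact: mulr_ge0].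
  by apply/funext => y; rewrite add0r mulrA.
rewrite (_ : (fun _ => _) = fun y => g y * (a * cos (L y)) +
    (a * b / 2) * cos (M y + L y) + (a * b / 2) * cos (M y - L y)).
  apply: posdef_cos; [apply: posdef_cos => //| |exact: intformB];
    by rewrite ?divr_ge0 ?mulr_ge0 //; exact: intformD.
by apply/funext => y; rewrite cosD cosB; field.
Qed.

Lemma posdefM (R : realType) (c d : R) g h :
  posdef c g -> posdef d h -> posdef (c * d) (fun y => g y * h y).
Proof.
move=> pg; elim=> [{}d d0|{}d {}h a L _ ih a0 fL].
  rewrite mulrC (_ : (fun _ => _) = fun y => d * g y); first exact: posdefZ.
  by apply/funext => y; rewrite mulrC.
rewrite -[c * d]addr0.
rewrite (_ : (fun _ => _) = fun y => g y * h y + g y * (a * cos (L y))).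
  by apply: posdefD => //; exact: posdefMcos pg a0 fL.
by apply/funext => y; rewrite mulrDr.
Qed.

(** The excess d - c is moved to a cosine term whose form is 0. *)
Lemma posdefW (R : realType) (c d : R) g : 0 <= c ->
  posdef d g -> c <= d -> posdef c g.
Proof.
move=> c0 pg; elim: pg c0 => [{}d d0|{}d {}g a L _ ih a0 fL] c0 cd.
  rewrite (_ : (fun _ => _) = fun=> c + (d - c) * cos ((fun=> 0) (fun _ : nat => 0 : R))).
    apply: posdef_cos; [exact: posdef_const|by rewrite subr_ge0|exact: intform0].
  by apply/funext => y; rewrite cos0 mulr1 subrKC.
by apply: posdef_cos => //; exact: ih.
Qed.

Lemma posdef_sum (R : realType) (I : Type) (s : seq I) (P : pred I)
    (g : I -> (nat -> R) -> R) :
  (forall i, P i -> posdef 0 (g i)) ->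
  posdef 0 (fun y => \sum_(i <- s | P i) g i y).
Proof.
move=> pg; elim: s => [|i s ih].
  rewrite (_ : (fun _ => _) = fun=> 0); first exact: posdef_const.
  by apply/funext => y; rewrite big_nil.
case Pi : (P i); last first.
  by rewrite (_ : (fun _ => _) = fun y => \sum_(i <- s | P i) g i y) //;
    apply/funext => y; rewrite big_cons Pi.
rewrite (_ : (fun _ => _) = fun y => g i y + \sum_(i <- s | P i) g i y).
  by have := posdefD (pg _ Pi) ih; rewrite addr0.
by apply/funext => y; rewrite big_cons Pi.
Qed.

(** Along the line t |-> t w - x, the cosine of L oscillates with frequency
    L(w).  The terms with L(w) = 0 are constant, and the hypothesis on x makes
    each of them equal to its nonnegative coefficient: they can only increase
    the mean. *)
Lemma posdef_line (R : realType) (w x : nat -> R) (c : R) g :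
  (forall L, intform L -> L w = 0 -> int2pi (L x)) ->
  posdef c g ->
  exists n, exists2 d, c <= d & trigsum n d (fun t => g (fun j => t * w j - x j)).
Proof.
move=> compat; elim=> [{}c c0|{}c {}g a L _ [n [d cd tg]] a0 fL].
  by exists 0%N, c => //; constructor.
have LE t : L (fun j => t * w j - x j) = t * L w - L x.
  under [in LHS]eq_fun do rewrite -[in X in _ - X](mul1r (x _)) -mulNr.
  by rewrite intform_linear // mulN1r.
have [Lw0|Lw0] := eqVneq (L w) 0.
  have [k kE] := compat _ fL Lw0.
  exists n, (d + a); first by rewrite (le_trans cd) // lerDl.
  suff -> : (fun t => g (fun j => t * w j - x j) + a * cos (L (fun j => t * w j - x j)))
     = fun t => g (fun j => t * w j - x j) + a.
    exact: trigsumDr.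
  apply/funext => t; rewrite LE Lw0 mulr0 sub0r cosN kE.
  by have := cosD2pi_int (0 : R) k; rewrite add0r cos0 => ->; rewrite mulr1.
exists n.+1, d => //.
rewrite (_ : (fun _ => _) = fun t => g (fun j => t * w j - x j) +
  (a * cos (L x) * cos (L w * t) + a * sin (L x) * sin (L w * t))).
  by constructor.
by apply/funext => t; rewrite LE cosB [t * _]mulrC; ring.
Qed.

Lemma posdef_mean_le (R : realType) (w x : nat -> R) (c B : R) g :
  (forall L, intform L -> L w = 0 -> int2pi (L x)) ->
  posdef c g -> (forall t, g (fun j => t * w j - x j) <= B) -> c <= B.
Proof.
move=> compat /(posdef_line compat)[n [d cd tg]] gB.
exact/(le_trans cd)/(trigsum_mean_le tg).
Qed.

(** * Kronecker's theorem *)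

(** The de la Vallee-Poussin kernel: it is 1 at the multiples of 2 pi, decays
    exponentially in m away from them, while its mean decays only like an
    inverse power of m. *)
Definition vp_kernel (R : realType) (m : nat) (y : R) : R := ((1 + cos y) / 2) ^+ m.

(** Pascal's rule, applied to
    2 cos z cos a = cos (a + z) + cos (a - z). *)
Lemma cos_pow_expansion (R : realType) (z : R) m :
  (2 * cos z) ^+ m =
  \sum_(k < m.+1) 'C(m, k)%:R * cos ((m%:R - 2 * k%:R) * z).
Proof.
elim: m => [|m ih].
  by rewrite expr0 big_ord1 bin0 mulr0 subrr mul0r cos0 mulr1.
have step k : 2 * cos z * cos ((m%:R - 2 * k%:R) * z) =
    cos ((m.+1%:R - 2 * k%:R) * z) + cos ((m.+1%:R - 2 * k.+1%:R) * z).
  have -> : (m.+1%:R - 2 * k%:R) * z = (m%:R - 2 * k%:R) * z + z.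
    by rewrite -natr1; ring.
  have -> : (m.+1%:R - 2 * k.+1%:R) * z = (m%:R - 2 * k%:R) * z - z.
    by rewrite -!natr1; ring.
  by rewrite cosD cosB; ring.
rewrite exprS ih mulr_sumr.
under eq_bigr do rewrite mulrCA step mulrDr.
rewrite big_split /= [RHS]big_ord_recl /= bin0 mul1r.
rewrite big_ord_recl /= bin0 mul1r -[LHS]addrA; congr (_ + _).
under [RHS]eq_bigr do rewrite /bump /= binS natrD mulrDl.
rewrite big_split /=; congr (_ + _).
  by rewrite big_ord_recr /= bin_small // mul0r addr0.
Qed.

(** The half-angle formula turns the kernel into an even power of a cosine. *)
Lemma vp_kernel_expansion (R : realType) (m : nat) (y : R) :
  vp_kernel m y = \sum_(k < m.*2.+1)
    'C(m.*2, k)%:R / 4 ^+ m * cos ((m%:R - k%:R) * y).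
Proof.
have -> : vp_kernel m y = (2 * cos (y / 2)) ^+ m.*2 / 4 ^+ m.
  rewrite -muln2 mulnC exprM -expr_div_n; congr (_ ^+ m).
  have -> : cos y = cos (y / 2 + y / 2) by congr cos; field.
  by rewrite cosD -!expr2 sin2cos2; field.
rewrite cos_pow_expansion mulr_suml; apply: eq_bigr => k _.
rewrite mulrAC; congr (_ * cos _).
by rewrite (_ : m.*2%:R = 2 * m%:R); [field|rewrite -mul2n natrM].
Qed.

(** The ratio 2 (2 m + 1) / (m + 1) of consecutive central coefficients is at
    least 4 (m + 1) / (m + 2). *)
Lemma central_bin_ge m : (4 ^ m <= m.+1 * 'C(m.*2, m))%N.
Proof.
elim: m => // m ih; rewrite doubleS.
have down := mul_bin_down m.*2.+1 m; have diag := mul_bin_diag m.*2.+2 m.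
rewrite /= in down diag; rewrite (_ : (m.*2.+1 - m = m.+1)%N) in down; last by lia.
rewrite expnS; nia.
Qed.

Lemma posdef_vp_kernel (R : realType) (j m : nat) :
  posdef (m.+1%:R^-1 : R) (fun y => vp_kernel m (y j)).
Proof.
have mm : (m < m.*2.+1)%N by lia.
rewrite (_ : (fun _ => _) = fun y => 'C(m.*2, m)%:R / 4 ^+ m +
  \sum_(k < m.*2.+1 | k != Ordinal mm)
    'C(m.*2, k)%:R / 4 ^+ m * cos ((m%:R - k%:R) * y j)); last first.
  apply/funext => y; rewrite vp_kernel_expansion (bigD1 (Ordinal mm)) //=.
  by rewrite subrr mul0r cos0 mulr1.
(* The central term of the expansion is the constant one; the others are
   cosines of integer multiples of the angle. *)
rewrite -[m.+1%:R^-1]addr0; apply: posdefD.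
  apply: posdefW (posdef_const _) _; rewrite ?invr_ge0 ?divr_ge0 ?exprn_ge0 //.
  rewrite ler_pdivlMr ?exprn_gt0 // ler_pdivrMl // -natrX -natrM ler_nat.
  exact: central_bin_ge.
apply: posdef_sum => k _.
rewrite (_ : (fun _ => _) = fun y => 0 + 'C(m.*2, k)%:R / 4 ^+ m *
   cos (y j *~ (m%:Z - k%:Z))).
  apply: posdef_cos; [exact: posdef_const|by rewrite divr_ge0 ?exprn_ge0|].
  exact/intformMz/intform_coord.
by apply/funext => y; rewrite add0r -mulrzl intrB.
Qed.

(** Exponential decay beats polynomial decay: q is at most exp (- (1 - q)), and
    the term of degree n + 1 of the exponential series bounds exp from below. *)
Lemma exists_pow_lt_inv_pow (R : realType) (q : R) (n : nat) :
  0 <= q -> q < 1 -> exists m : nat, q ^+ m < (m.+1%:R^-1) ^+ n.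
Proof.
move=> q0 q1; pose b := 1 - q; have b0 : 0 < b by rewrite subr_gt0.
have [m] : exists m : nat, 2 ^+ n * n.+1`!%:R / b ^+ n.+1 < m%:R.
  exists (Num.bound (2 ^+ n * n.+1`!%:R / b ^+ n.+1)).
  by apply: archi_boundP; rewrite divr_ge0 ?mulr_ge0 ?exprn_ge0 ?ltW.
rewrite ltr_pdivrMr ?exprn_gt0 // => mbig; exists m.
have m0 : (0 < m)%N.
  case: m mbig => //; rewrite mul0r.
  by rewrite ltNge mulr_ge0 // exprn_ge0.
have qE : q <= expR (- b).
  by apply: le_trans (expR_ge1Dx _); rewrite /b; lra.
apply: (@le_lt_trans _ _ (expR (- (b * m%:R)))).
  by rewrite -mulNr expRM_natr lerXn2r ?nnegrE ?expR_ge0.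
rewrite expRN exprVn ltf_pV2 ?posrE ?expR_gt0 ?exprn_gt0 //.
have bm0 : 0 <= b * m%:R by rewrite mulr_ge0 // ltW.
apply: lt_le_trans (expR_ge1Dxn n bm0).
apply: (@le_lt_trans _ _ ((2 * m%:R) ^+ n)).
  by rewrite lerXn2r ?nnegrE ?mulr_ge0 // -natrM ler_nat; lia.
(* It remains to compare with the term of degree n + 1 of the series; m was
   chosen for this. *)
suff : (2 * m%:R) ^+ n < (b * m%:R) ^+ n.+1 / n.+1`!%:R by lra.
rewrite ltr_pdivlMr ?ltr0n ?fact_gt0 // !exprMn exprS [m%:R ^+ n.+1]exprS.
have m0n : 0 < m%:R ^+ n :> R by rewrite exprn_gt0 ?ltr0n.
move: mbig; rewrite exprS -(ltr_pM2r m0n) => mbig.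
by apply: le_lt_trans (lt_le_trans mbig _); rewrite le_eqVlt; apply/orP; left;
  apply/eqP; ring.
Qed.

(** If the line t |-> t w stayed away from x in the first n coordinates, then
    the product of the kernels in these coordinates would be at most q ^ m along
    t w - x, with q < 1 independent of m.  Its mean is at least the product of
    the constant coefficients, which is at least (m + 1) ^ - n: this is
    impossible for large m. *)
Theorem kronecker (R : realType) (w x : nat -> R) :
  (forall L, intform L -> L w = 0 -> int2pi (L x)) ->
  forall n (e : R), 0 < e ->
  exists t, forall j, (j < n)%N -> near2pi e (w j * t - x j).
Proof.
move=> compat n e0 e0gt.
pose e := Num.min e0 pi.
have egt : 0 < e by rewrite lt_min e0gt pi_gt0.
have epi : e <= pi by rewrite ge_min lexx orbT.
have ee0 : e <= e0 by rewrite ge_min lexx.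
apply: contrapT => far; pose q := (1 + cos e) / 2 : R.
have q0 : 0 <= q by have := cos_geN1 e; rewrite /q; lra.
have q1 : q < 1.
  have : cos e < cos 0.
    by rewrite ltr_cos // in_itv /= ?lexx ?pi_ge0 // ltW.
  by rewrite cos0 /q; lra.
have [m qm] := exists_pow_lt_inv_pow n q0 q1.
have prodpd : posdef (m.+1%:R^-1 ^+ n)
    (fun y : nat -> R => \prod_(j < n) vp_kernel m (y j)).
  elim: n {far qm} => [|n ihn].
    rewrite (_ : (fun _ => _) = fun=> 1); first exact: posdef_const.
    by apply/funext => y; rewrite big_ord0.
  rewrite exprSr (_ : (fun _ => _) =
    fun y : nat -> R => (\prod_(j < n) vp_kernel m (y j)) * vp_kernel m (y n)).
    by apply: posdefM => //; exact: posdef_vp_kernel.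
  by apply/funext => y; rewrite big_ord_recr.
have base (y : R) : 0 <= (1 + cos y) / 2 <= 1.
  by have := cos_geN1 y; have := cos_le1 y; lra.
have vp01 (y : R) : 0 <= vp_kernel m y <= 1.
  by have /andP[? ?] := base y; rewrite exprn_ge0 ?exprn_ile1.
move: qm; rewrite ltNge => /negP; apply; apply: posdef_mean_le compat prodpd _ => t.
have [j jn nj] : exists2 j, (j < n)%N & ~ near2pi e (t * w j - x j).
  apply: contrapT => near; apply: far; exists t => j jn.
  apply: contrapT => nj; apply: near; exists j => // -[k ke].
  by apply: nj; exists k; rewrite (lt_le_trans _ ee0) // [_ * t]mulrC.
rewrite (bigD1 (Ordinal jn)) //= -[q ^+ m]mulr1; apply: ler_pM.
- by have /andP[] := vp01 (t * w j - x j).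
- by apply: prodr_ge0 => i _; have /andP[] := vp01 (t * w i - x i).
- have /andP[? ?] := base (t * w j - x j).
  rewrite lerXn2r ?nnegrE // /q ler_pM2r // lerD2l cos_le_of_not_near2pi //.
  by rewrite epi ltW.
by apply: prodr_ile1 => i _; exact: vp01.
Qed.

(** * Continuity modulo 2 pi *)

(** Continuity of the map into the circle that phi represents. *)
Definition contmod (R : realType) (T : topologicalType) (phi : T -> R) : Prop :=
  forall x e, 0 < e -> \forall y \near x, near2pi e (phi y - phi x).

Lemma contmod_continuous (R : realType) (T : topologicalType) (u : T -> R) :
  continuous u -> contmod u.
Proof.
move=> cu x e e0; have /cvgrPdist_lt/(_ e e0) := cu x.
by apply: filterS => y; rewrite distrC; exact: near2pi_norm.
Qed.

Lemma contmodD (R : realType) (T : topologicalType) (phi psi : T -> R) :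
  contmod phi -> contmod psi -> contmod (fun x => phi x + psi x).
Proof.
move=> cphi cpsi x e e0; have e20 : 0 < e / 2 by rewrite divr_gt0.
near=> y; rewrite opprD addrACA [e]splitr; apply: near2piD; near: y.
  exact: cphi.
exact: cpsi.
Unshelve. all: by end_near. Qed.

Lemma contmodN (R : realType) (T : topologicalType) (phi : T -> R) :
  contmod phi -> contmod (fun x => - phi x).
Proof.
move=> cphi x e e0; apply: filterS (cphi x e e0) => y.
by rewrite -opprD; exact: near2piN.
Qed.

Lemma contmodB (R : realType) (T : topologicalType) (phi psi : T -> R) :
  contmod phi -> contmod psi -> contmod (fun x => phi x - psi x).
Proof. by move=> cphi /contmodN; exact: contmodD. Qed.

Lemma contmod_cst (R : realType) (T : topologicalType) (c : R) :
  contmod (fun _ : T => c).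
Proof. by apply: contmod_continuous; exact: cst_continuous. Qed.

Lemma contmod_intform (R : realType) (T : topologicalType)
    (L : (nat -> R) -> R) (phi : nat -> T -> R) :
  intform L -> (forall j, contmod (phi j)) ->
  contmod (fun x => L (phi ^~ x)).
Proof.
move=> fL cphi; elim: fL => // [|M N _ ? _ ?|M _ ?].
- exact: contmod_cst.
- exact: contmodD.
- exact: contmodN.
Qed.

Lemma contmod_comp (R : realType) (S T : topologicalType) (f : S -> T)
    (phi : T -> R) : continuous f -> contmod phi -> contmod (phi \o f).
Proof. by move=> cf cphi x e e0; have := cf x _ (cphi (f x) e e0). Qed.

Lemma contmod_int2pi (R : realType) (T : topologicalType) (phi psi : T -> R) :
  (forall x, int2pi (psi x - phi x)) -> contmod phi -> contmod psi.
Proof.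
move=> pp cphi x e e0; apply: filterS (cphi x e e0) => y; apply: near2pi_int2pi.
by have := int2piB (pp x) (pp y); congr int2pi; ring.
Qed.

(** A lift of a continuous circle-valued map is continuous once it has no jumps
    of size comparable to 2 pi. *)
Lemma contmod_small_osc (R : realType) (T : topologicalType) (v : T -> R) :
  contmod v -> (forall x, \forall y \near x, `|v y - v x| < pi) -> continuous v.
Proof.
move=> cv osc x; apply/cvgrPdist_lt => e e0; pose d := Num.min e pi.
have d0 : 0 < d by rewrite lt_min e0 pi_gt0.
have de : d <= e by rewrite ge_min lexx.
have dpi : d <= pi by rewrite ge_min lexx orbT.
near=> y; rewrite distrC; apply: lt_le_trans de; apply: near2pi_norm_lt.
  by near: y; exact: cv.
apply: (@le_trans _ _ pi); last by lra.
by apply: ltW; near: y; exact: osc.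
Unshelve. all: by end_near. Qed.

(** * The topology of the infinite torus *)

Lemma torus_liftP (R : realType) (x : R) :
  int2pi (torus_lift (to_torus x) - x).
Proof. by apply/to_torusP; exact: reprK. Qed.

Lemma torus_liftK (R : realType) (p : torus R) : to_torus (torus_lift p) = p.
Proof. exact: reprK. Qed.

(** The representatives chosen in R jump, but only by multiples of 2 pi. *)
Lemma contmod_torus_lift (R : realType) : contmod (@torus_lift R).
Proof.
move=> p e e0; pose U := [set q : torus R | near2pi e (torus_lift q - torus_lift p)].
have -> : (\forall q \near p, near2pi e (torus_lift q - torus_lift p)) = nbhs p U by [].
apply: open_nbhs_nbhs; split; last by apply: near2pi_norm; rewrite subrr normr0.
have : open [set x : R | near2pi e (x - torus_lift p)].
  rewrite openE => x [k ke]; apply/nbhs_ballP.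
  exists (e - `|x - torus_lift p - k%:~R * (2 * pi)|) => /=.
    by rewrite subr_gt0.
  move=> y; rewrite /ball /= => xy; exists k.
  have -> : y - torus_lift p - k%:~R * (2 * pi) =
    (x - torus_lift p - k%:~R * (2 * pi)) - (x - y) by ring.
  by apply: le_lt_trans (ler_normB _ _) _; lra.
suff -> : [set x : R | near2pi e (x - torus_lift p)] = @to_torus R @^-1` U by [].
have cong x : int2pi (torus_lift (to_torus x) - torus_lift p - (x - torus_lift p)).
  by rewrite opprB addrA subrK; exact: torus_liftP.
apply/seteqP; split => x; apply: near2pi_int2pi; last exact: cong.
by rewrite -opprB; exact/int2piN/cong.
Qed.

Lemma nbhs_torusP (R : realType) (p : torus R) (U : set (torus R)) :
  nbhs p U ->
  exists2 e, 0 < e & forall q, near2pi e (torus_lift q - torus_lift p) -> U q.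
Proof.
rewrite -{1}[p]torus_liftK => nU.
have /(_ _ nU) : {for torus_lift p, continuous (@to_torus R)} by exact: pi_continuous.
move=> /nbhs_ballP[e /= e0 be]; exists e => // q [k ke].
suff -> : q = to_torus (torus_lift q - k%:~R * (2 * pi)).
  by apply: be; rewrite /ball /= distrC addrAC.
rewrite -[LHS]torus_liftK; apply/to_torusP; exists k; ring.
Qed.

Lemma continuous_to_torus (R : realType) (T : topologicalType) (phi : T -> R) :
  contmod phi -> continuous (fun x => to_torus (phi x) : torus R).
Proof.
move=> cphi x U /nbhs_torusP[e e0 eU]; apply: filterS (cphi x e e0) => y ny.
apply: eU; apply: near2pi_int2pi ny.
rewrite (_ : _ - _ = (torus_lift (to_torus (phi x)) - phi x) -
  (torus_lift (to_torus (phi y)) - phi y)); last by ring.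
by apply: int2piB; exact: torus_liftP.
Qed.

(** These conditions on finitely many coordinates form a neighbourhood basis of
    the product topology. *)
Definition near_coords (R : realType) (n : nat) (e : R) (x y : inf_torus R) : Prop :=
  forall j, (j < n)%N -> near2pi e (torus_lift (x j) - torus_lift (y j)).

Lemma near_coords_sym (R : realType) n e (x y : inf_torus R) :
  near_coords n e x y -> near_coords n e y x.
Proof. by move=> xy j /xy /near2pi_sub_sym. Qed.

Lemma near_coords_trans (R : realType) n d e (x y z : inf_torus R) :
  near_coords n d x y -> near_coords n e y z -> near_coords n (d + e) x z.
Proof. by move=> xy yz j jn; exact: near2pi_sub_trans (xy j jn) (yz j jn). Qed.

Lemma near_coordsW (R : realType) m n d e (x y : inf_torus R) :
  (m <= n)%N -> d <= e -> near_coords n d x y -> near_coords m e x y.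
Proof.
by move=> mn de xy j jm; apply: near2piW de (xy j _); exact: leq_trans jm mn.
Qed.

Lemma contmod_coord (R : realType) (j : nat) :
  contmod (fun x : inf_torus R => torus_lift (x j)).
Proof.
apply: (@contmod_comp R (inf_torus R) (torus R) (fun x => x j)); last first.
  exact: contmod_torus_lift.
exact: (@proj_continuous nat (fun=> torus R) j).
Qed.

Lemma nbhs_near_coords (R : realType) (n : nat) (e : R) (x : inf_torus R) : 0 < e ->
  \forall y \near x, near_coords n e y x.
Proof.
move=> e0; elim: n => [|n ihn]; first by near=> y.
near=> y; rewrite /near_coords => j; rewrite ltnS leq_eqVlt => /orP[/eqP ->|].
  by near: y; exact: contmod_coord.
by move: j; near: y.
Unshelve. all: by end_near. Qed.

(** Otherwise, points outside U but closer and closer to x in more and more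
    coordinates would converge to x. *)
Lemma nbhs_near_coordsP (R : realType) (x : inf_torus R) (U : set (inf_torus R)) :
  nbhs x U -> exists n e, 0 < e /\ forall y, near_coords n e y x -> U y.
Proof.
move=> nU; apply: contrapT => noclose.
have /choice[y yP] n : exists y, near_coords n n.+1%:R^-1 y x /\ ~ U y.
  apply: contrapT => non; apply: noclose; exists n, n.+1%:R^-1; split => // y cy.
  by apply: contrapT => Uy; apply: non; exists y.
have : y @ \oo --> x.
  apply/cvg_sup => j; apply/cvg_image.
    by apply/seteqP; split => // p _; exists (fun=> p).
  move=> V /= /nbhs_torusP[e e0 eV]; exists ((fun z : nat -> torus R => z j) @^-1` V); last first.
    by apply: image_preimage; apply/seteqP; split => // p _; exists (fun=> p).
  have [N _ Ne] := near_infty_natSinv_lt (PosNum e0).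
  exists (maxn N j.+1) => // n /=; rewrite geq_max => /andP[Nn jn].
  apply: eV; have [/(_ _ jn) + _] := yP n; apply: near2piW.
  exact/ltW/Ne.
by move=> /(_ _ nU) [N _ NU]; have [_] := yP N; apply; apply: NU => /=.
Qed.

Lemma continuous_inf_torus (R : realType) (S : topologicalType)
    (phi : S -> nat -> R) :
  (forall j, contmod (phi ^~ j)) ->
  continuous (fun s => (fun j => to_torus (phi s j)) : inf_torus R).
Proof.
move=> cphi s; apply/cvg_sup => j; apply/cvg_image.
  by apply/seteqP; split => // p _; exists (fun=> p).
move=> V /= /(continuous_to_torus (cphi j)) nV.
exists ((fun z : nat -> torus R => z j) @^-1` V) => //.
by apply: image_preimage; apply/seteqP; split => // p _; exists (fun=> p).
Qed.

Lemma continuous_val (T : topologicalType) (A : set T) :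
  continuous (fun x : set_type A => val x).
Proof. exact: (@initial_continuous (set_type A) T set_val). Qed.

Lemma nbhs_set_type (T : topologicalType) (A : set T) (x : set_type A)
    (U : set (set_type A)) :
  nbhs x U -> exists2 V, nbhs (val x) V & forall y : set_type A, V (val y) -> U y.
Proof.
move=> [_ [[V oV <-] Vx VU]]; exists V; first exact: open_nbhs_nbhs.
by move=> y Vy; exact: VU.
Qed.

Lemma continuous_set_type (S T : topologicalType) (A : set T)
    (f : S -> set_type A) :
  continuous (fun x => val (f x)) -> continuous f.
Proof.
move=> cf x U /nbhs_set_type[V Vx VU].
have cfV := cf x V Vx; apply: (@filterS _ (nbhs x) _ _ _ _ cfV) => y.
exact: VU.
Qed.

Lemma contmod_val_intform (R : realType) (A : set (inf_torus R))
    (L : (nat -> R) -> R) : intform L ->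
  contmod (fun x : set_type A => L (fun j => torus_lift (val x j))).
Proof.
move=> fL.
apply: (@contmod_intform R _ L (fun j (x : set_type A) => torus_lift (val x j))) => // j.
exact: (contmod_comp (@continuous_val _ A) (@contmod_coord R j)).
Qed.

(** * Orbit closures as annihilators *)

Lemma kronecker_flow_lift (R : realType) (w : nat -> R) t (theta : inf_torus R) j :
  int2pi (torus_lift (kronecker_flow w t theta j) - (torus_lift (theta j) + w j * t)).
Proof. exact: torus_liftP. Qed.

(** A relation L(w) = 0 holds along the whole orbit and is closed, hence passes
    to the closure.  The converse is Kronecker's theorem. *)
Lemma closure_orbitP (R : realType) (w : nat -> R) (theta x : inf_torus R) :
  closure (kronecker_orbit w theta) x <->
  forall L, intform L -> L w = 0 ->
    int2pi (L (fun j => torus_lift (x j) - torus_lift (theta j))).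
Proof.
split=> [cx L fL Lw|rel U /nbhs_near_coordsP[n [e [e0 eU]]]].
  apply: near2pi_all_int2pi => e e0.
  pose phi j (y : inf_torus R) := torus_lift (y j) - torus_lift (theta j).
  have cphi : contmod (fun y => L (phi ^~ y)).
    apply: contmod_intform => // j.
    by apply: contmodB; [exact: contmod_coord|exact: contmod_cst].
  have [_ [[t _ <-]]] := cx _ (cphi x e e0).
  move=> /near2pi_sub_sym; apply: near2pi_int2pi.
  rewrite /= addrAC subrr add0r; apply: int2piN.
  have := @int2pi_intform _ L (fun j => phi j (kronecker_flow w t theta) - t * w j) fL.
  rewrite intformBE // intformZ // Lw mulr0 subr0; apply => j.
  by rewrite /phi -addrA -opprD [t * _]mulrC; exact: kronecker_flow_lift.
have [t tP] := kronecker rel n e0.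
exists (kronecker_flow w t theta); split; first by exists t.
apply: eU => j /tP; apply: near2pi_int2pi.
rewrite -opprB; apply: int2piN.
rewrite (_ : _ - _ = torus_lift (kronecker_flow w t theta j) -
   (torus_lift (theta j) + w j * t)); last by ring.
exact: kronecker_flow_lift.
Qed.

(** * Isomorphic modules give homeomorphic closures *)

(** The substitution of the integral forms B for the coordinates, centred so as
    to map theta to theta'. *)
Definition transfer (R : realType) (B : nat -> (nat -> R) -> R)
    (theta theta' x : inf_torus R) : inf_torus R :=
  fun i => to_torus (torus_lift (theta' i) +
                     B i (fun j => torus_lift (x j) - torus_lift (theta j))).

Lemma transfer_lift (R : realType) (B : nat -> (nat -> R) -> R)
    (theta theta' x : inf_torus R) i :
  int2pi (torus_lift (transfer B theta theta' x i) - torus_lift (theta' i) -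
          B i (fun j => torus_lift (x j) - torus_lift (theta j))).
Proof. by rewrite -addrA -opprD; exact: torus_liftP. Qed.

Lemma continuous_transfer (R : realType) (B : nat -> (nat -> R) -> R)
    (theta theta' : inf_torus R) :
  (forall i, intform (B i)) ->
  continuous (transfer B theta theta').
Proof.
move=> fB.
pose phi (x : inf_torus R) i := torus_lift (theta' i) +
  B i (fun j => torus_lift (x j) - torus_lift (theta j)).
apply: (@continuous_inf_torus R (inf_torus R) phi) => i.
apply: contmodD; first exact: contmod_cst.
pose psi j (x : inf_torus R) := torus_lift (x j) - torus_lift (theta j).
apply: (@contmod_intform R (inf_torus R) (B i) psi) => // j.
by apply: contmodB; [exact: contmod_coord|exact: contmod_cst].
Qed.

(** The hypothesis on B says that substituting B sends relations between the w'
    to relations between the w. *)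
Lemma transfer_closure (R : realType) (B : nat -> (nat -> R) -> R)
    (w w' : nat -> R) (theta theta' x : inf_torus R) :
  (forall i, intform (B i)) ->
  (forall L, intform L -> L w' = 0 -> L (fun i => B i w) = 0) ->
  closure (kronecker_orbit w theta) x ->
  closure (kronecker_orbit w' theta') (transfer B theta theta' x).
Proof.
move=> fB Bw /closure_orbitP rel; apply/closure_orbitP => L fL /(Bw _ fL) LBw.
have := rel _ (intform_comp fL fB) LBw.
set z := fun j => torus_lift (x j) - torus_lift (theta j) => relB.
pose y i := torus_lift (transfer B theta theta' x i) - torus_lift (theta' i).
have yB : int2pi (L (fun i => y i - B i z)).
  by apply: int2pi_intform => // i; exact: transfer_lift.
by have := int2piD yB relB; rewrite intformBE // subrK.
Qed.

(** That A after B fixes w coordinatewise is a family of relations between the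
    w, hence it also holds at every point of the closure. *)
Lemma transfer_cancel (R : realType) (A B : nat -> (nat -> R) -> R)
    (w : nat -> R) (theta theta' x : inf_torus R) :
  (forall i, intform (A i)) -> (forall i, intform (B i)) ->
  (forall i, A i (fun j => B j w) = w i) ->
  closure (kronecker_orbit w theta) x ->
  transfer A theta' theta (transfer B theta theta' x) = x.
Proof.
move=> fA fB ABw /closure_orbitP rel; apply/funext => i.
rewrite -[RHS]torus_liftK; apply/to_torusP.
set z := fun j => torus_lift (x j) - torus_lift (theta j) in rel.
set y := fun j => torus_lift (transfer B theta theta' x j) - torus_lift (theta' j).
have yB : int2pi (A i (fun j => y j - B j z)).
  by apply: int2pi_intform => // j; exact: transfer_lift.
have := rel _ (intformB (intform_comp (fA i) fB) (intform_coord R i)).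
rewrite ABw subrr => /(_ erefl) /(int2piD yB); rewrite intformBE // addrA subrK.
by rewrite /z opprB addrA [torus_lift (theta i) + _]addrC.
Qed.

(** A morphism of modules is determined by the images of the generators w_i,
    each of which is an integral form in the w'. *)
Lemma morphism_forms (R : realType) (w w' : nat -> R)
    (h : freq_group w -> freq_group w') :
  {morph h : x y / x - y} ->
  exists2 A : nat -> (nat -> R) -> R, (forall i, intform (A i)) &
    forall L (m : freq_group w), intform L -> val m = L w ->
      val (h m) = L (fun i => A i w').
Proof.
move=> hB; have h0 : h 0 = 0 by rewrite -(subrr 0) hB subrr.
have hN x : h (- x) = - h x by rewrite -sub0r hB h0 sub0r.
have hD x y : h (x + y) = h x + h y by rewrite -{1}[y]opprK hB hN opprK.
have mem L : intform L -> L w \in freq_module w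
  by move=> fL; apply/freq_moduleP; exists L.
pose elt L (fL : intform L) : freq_group w :=
  exist (fun x => x \in freq_module w) (L w) (mem L fL).
have /choice[A AP] i : exists A, intform A /\
    val (h (elt _ (intform_coord R i))) = A w'.
  by have /freq_moduleP[A fA AE] := valP (h (elt _ (intform_coord R i))); exists A.
exists A => [i|L m fL]; first by have [] := AP i.
elim: fL m => [j||M N fM ihM fN ihN|M fM ihM] m mE.
- by have [_ <-] := AP j; congr (val (h _)); apply: val_inj.
- by rewrite (_ : m = 0) ?h0 //; apply: val_inj.
- rewrite -(ihM (elt _ fM)) // -(ihN (elt _ fN)) //.
  rewrite -raddfD -hD; congr (val (h _)); exact: val_inj.
- rewrite -(ihM (elt _ fM)) // -raddfN -hN.
  by congr (val (h _)); apply: val_inj.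
Qed.

Lemma homeomorphic_set_type (S T : topologicalType) (A : set S) (B : set T)
    (f : S -> T) (g : T -> S) :
  continuous f -> continuous g ->
  (forall x, A x -> B (f x)) -> (forall y, B y -> A (g y)) ->
  (forall x, A x -> g (f x) = x) -> (forall y, B y -> f (g y) = y) ->
  homeomorphic (set_type A) (set_type B).
Proof.
move=> cf cg fB gA gf fg.
have memf (x : set_type A) : f (val x) \in B by apply/mem_set/fB/set_mem/(valP x).
have memg (y : set_type B) : g (val y) \in A by apply/mem_set/gA/set_mem/(valP y).
exists (fun x => exist (fun y => y \in B) _ (memf x)),
  (fun y => exist (fun x => x \in A) _ (memg y)); split.
- apply: continuous_set_type => x /=.
  by apply: continuous_comp; [exact: continuous_val|exact: cf].
- apply: continuous_set_type => y /=.
  by apply: continuous_comp; [exact: continuous_val|exact: cg].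
- by move=> x; apply: val_inj => /=; apply/gf/set_mem/(valP x).
- by move=> y; apply: val_inj => /=; apply/fg/set_mem/(valP y).
Qed.

Lemma iso_homeomorphic (R : realType) (w w' : nat -> R) :
  zmod_isomorphic (freq_group w) (freq_group w') ->
  forall theta theta' : inf_torus R,
     homeomorphic (set_type (closure (kronecker_orbit w theta)))
                  (set_type (closure (kronecker_orbit w' theta'))).
Proof.
move=> [h [g hg gh]] theta theta'.
have hB : {morph h : x y / x - y} by exact: raddfB.
have gB : {morph g : x y / x - y}.
  by move=> x y; rewrite -{1}[x]gh -{1}[y]gh -raddfB hg.
have [A fA AE] := morphism_forms hB; have [B fB BE] := morphism_forms gB.
have kernel (u u' : nat -> R) (k : freq_group u -> freq_group u') C :
    {morph k : x y / x - y} ->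
    (forall L (m : freq_group u), intform L -> val m = L u ->
      val (k m) = L (fun i => C i u')) ->
    forall L, intform L -> L u = 0 -> L (fun i => C i u') = 0.
  move=> kB CE L fL Lu; rewrite -(CE L 0 fL) // -[X in k X](subrr 0) kB subrr //.
have inverse (u u' : nat -> R) (k : freq_group u -> freq_group u')
    (l : freq_group u' -> freq_group u) C D : cancel k l ->
    (forall i, intform (C i)) ->
    (forall L (m : freq_group u), intform L -> val m = L u ->
      val (k m) = L (fun i => C i u')) ->
    (forall L (m : freq_group u'), intform L -> val m = L u' ->
      val (l m) = L (fun i => D i u)) ->
    forall i, C i (fun j => D j u) = u i.
  move=> kl fC CE DE i.
  have ui : u i \in freq_module u.
    by apply/freq_moduleP; exists (fun z => z i) => //; exact: intform_coord.
  pose e : freq_group u := exist (fun x => x \in freq_module u) (u i) ui.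
  rewrite -(DE _ (k e)) ?kl //.
  by rewrite (CE (fun z => z i)) //; exact: intform_coord.
apply: (@homeomorphic_set_type _ _ _ _
  (transfer B theta theta') (transfer A theta' theta)).
- exact: continuous_transfer.
- exact: continuous_transfer.
- by move=> x; apply: transfer_closure => //; exact: kernel gB BE.
- by move=> x; apply: transfer_closure => //; exact: kernel hB AE.
- by move=> x; apply: transfer_cancel => //; exact: inverse hg fA AE BE.
- by move=> x; apply: transfer_cancel => //; exact: inverse gh fB BE AE.
Qed.

(** * The closure of the orbit of the origin *)

Definition torus_origin (R : realType) : inf_torus R := fun=> to_torus 0.

Definition hull (R : realType) (w : nat -> R) : set (inf_torus R) :=
  closure (kronecker_orbit w (torus_origin R)).

Lemma hullP (R : realType) (w : nat -> R) (x : inf_torus R) :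
  hull w x <-> forall L, intform L -> L w = 0 ->
                 int2pi (L (fun j => torus_lift (x j))).
Proof.
have origin L : intform L -> int2pi (L (fun j => torus_lift (torus_origin R j))).
  move=> fL; apply: int2pi_intform => // j.
  by rewrite -[torus_lift _]subr0; exact: torus_liftP.
split=> [/closure_orbitP rel L fL Lw|rel].
  by have := int2piD (rel L fL Lw) (origin L fL); rewrite intformBE // subrK.
apply/closure_orbitP => L fL Lw.
by rewrite intformBE //; apply: int2piB; [exact: rel|exact: origin].
Qed.

Definition orbit_point (R : realType) (w : nat -> R) (t : R) : set_type (hull w) :=
  exist (fun x => x \in hull w) (kronecker_flow w t (torus_origin R))
    (mem_set (subset_closure (imageP _ I))).

Lemma orbit_point_lift (R : realType) (w : nat -> R) t j :
  int2pi (torus_lift (val (orbit_point w t) j) - w j * t).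
Proof.
rewrite -[X in int2pi X](subrK (torus_lift (torus_origin R j))).
apply: int2piD; last by rewrite -[torus_lift _]subr0; exact: torus_liftP.
by rewrite -addrA -opprD [w j * t + _]addrC; exact: kronecker_flow_lift.
Qed.

Lemma orbit_point_diff (R : realType) (w : nat -> R) s t j :
  int2pi (torus_lift (val (orbit_point w s) j) -
          torus_lift (val (orbit_point w t) j) - w j * (s - t)).
Proof.
have := int2piB (orbit_point_lift w s j) (orbit_point_lift w t j).
by congr int2pi; ring.
Qed.

Lemma intform_orbit_point (R : realType) (w : nat -> R) t L : intform L ->
  int2pi (L (fun j => torus_lift (val (orbit_point w t) j)) - L w * t).
Proof.
move=> fL; rewrite mulrC -intformZ // -intformBE //.
by apply: int2pi_intform => // j; rewrite mulrC; exact: orbit_point_lift.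
Qed.

Lemma orbit_point_dense (R : realType) (w : nat -> R) (x : set_type (hull w))
    n (e : R) :
  0 < e -> exists t, near_coords n e (val (orbit_point w t)) (val x).
Proof.
move=> e0; have /set_mem cx := valP x.
by have [_ [[t _ <-] ct]] := cx _ (nbhs_near_coords n (val x) e0); exists t.
Qed.

Lemma continuous_orbit_point (R : realType) (w : nat -> R) :
  continuous (orbit_point w).
Proof.
apply: continuous_set_type.
apply: (@continuous_inf_torus R R
  (fun t j => torus_lift (torus_origin R j) + w j * t)) => j.
apply: contmod_continuous => t.
by apply: cvgD; [exact: cvg_cst|apply: cvgMr; exact: cvg_id].
Qed.

Lemma hull_nbhsP (R : realType) (w : nat -> R) (x : set_type (hull w))
    (U : set (set_type (hull w))) : nbhs x U ->
  exists n e, 0 < e /\ forall y : set_type (hull w), near_coords n e (val y) (val x) -> U y.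
Proof.
move=> /nbhs_set_type[V /nbhs_near_coordsP[n [e [e0 eV]]] VU].
by exists n, e; split => // y /eV /VU.
Qed.

Lemma hull_nbhs_near_coords (R : realType) (w : nat -> R) (x : set_type (hull w))
    n (e : R) :
  0 < e -> \forall y \near x, near_coords n e (val y) (val x).
Proof. by move=> e0; have := continuous_val (nbhs_near_coords n (val x) e0). Qed.

Lemma compact_torus (R : realType) : compact [set: torus R].
Proof.
have -> : [set: torus R] = @to_torus R @` `[- pi, pi].
  apply/seteqP; split => // p _; have [k] := exists_norm_le_pi (torus_lift p).
  rewrite ler_norml => kE.
  exists (torus_lift p - k%:~R * (2 * pi)); first by rewrite /= in_itv.
  rewrite -[RHS]torus_liftK; apply/to_torusP; exists (- k).
  by rewrite mulrNz mulNr; ring.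
apply: continuous_compact; last exact: segment_compact.
by apply: continuous_subspaceT => x; exact: pi_continuous.
Qed.

(** Tychonoff's theorem, in the form used below: every sequence has a cluster
    point. *)
Lemma hull_cluster (R : realType) (w : nat -> R) (s : nat -> set_type (hull w)) :
  exists x : set_type (hull w), forall n (e : R) N, 0 < e ->
    exists2 m, (N <= m)%N & near_coords n e (val (s m)) (val x).
Proof.
have cT : compact [set: inf_torus R].
  have -> : [set: inf_torus R] = [set f | forall j : nat, [set: torus R] (f j)].
    by apply/seteqP; split.
  apply: (@tychonoff nat (fun=> torus R) (fun=> setT)).
  by move=> j; exact: compact_torus.
have ch : compact (hull w).
  by apply: (subclosed_compact _ cT) => //; exact: closed_closure.
have [] := ch ((fun m => val (s m)) @ \oo) _ _.
  by exists 0%N => // m _; exact: (set_mem (valP (s m))).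
move=> x [hx cx]; exists (exist (fun x => x \in hull w) x (mem_set hx)) => n e N e0.
have [_ [[m /= Nm <-] cm]] :
    [set val (s m) | m in [set m | (N <= m)%N]] `&` (near_coords n e ^~ x) !=set0.
  apply: cx; last exact: nbhs_near_coords.
  by exists N => // m Nm; exists m.
by exists m.
Qed.

Lemma hull_bounded (R : realType) (w : nat -> R) (u : set_type (hull w) -> R) :
  continuous u -> exists B, forall x, `|u x| <= B.
Proof.
move=> cu; apply: contrapT => unb.
have /choice[s sP] m : exists x, m%:R < `|u x|.
  apply: contrapT => nx; apply: unb; exists m%:R => x.
  by rewrite leNgt; apply/negP => xm; apply: nx; exists x.
have [x xP] := hull_cluster s.
have /cvgrPdist_lt/(_ 1 ltr01) := cu x.
move=> /hull_nbhsP[n [e [e0 eU]]].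
have [m Nm /eU] := xP n e (Num.bound (`|u x| + 1)) e0.
have := sP m; have := archi_boundP (_ : 0 <= `|u x| + 1); rewrite addr_ge0 // => /(_ isT).
move=> b1 b2; rewrite ltNge => /negP; apply.
have : (Num.bound (`|u x| + 1))%:R <= m%:R :> R by rewrite ler_nat.
have := ler_normB (u x) (u x - u (s m)); rewrite opprB addrC subrK; lra.
Qed.

(** Compactness: pairs of points that are closer and closer but have distant
    images would cluster at a point where phi is discontinuous. *)
Lemma hull_unif_contmod (R : realType) (w : nat -> R)
    (phi : set_type (hull w) -> R) (e : R) :
  contmod phi -> 0 < e -> exists n d, 0 < d /\
    forall x y : set_type (hull w), near_coords n d (val x) (val y) ->
      near2pi e (phi x - phi y).
Proof.
move=> cphi e0; apply: contrapT => nonunif.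
have /choice[s sP] n : exists xy : set_type (hull w) * set_type (hull w),
    near_coords n n.+1%:R^-1 (val xy.1) (val xy.2) /\ ~ near2pi e (phi xy.1 - phi xy.2).
  apply: contrapT => nxy; apply: nonunif; exists n, n.+1%:R^-1; split => // x y cxy.
  by apply: contrapT => nn; apply: nxy; exists (x, y).
(* Both components of the pairs cluster at x. *)
have [x xP] := hull_cluster (fun n => (s n).1).
have e20 : 0 < e / 2 by rewrite divr_gt0.
have /hull_nbhsP[n [d [d0 dU]]] := cphi x _ e20.
have d20 : 0 < d / 2 by rewrite divr_gt0.
have [N _ NE] := near_infty_natSinv_lt (PosNum d20).
have [m Nm c1] := xP n (d / 2) (maxn n N) d20.
have [c12 []] := sP m.
have c2 : near_coords n (d / 2 + d / 2) (val (s m).2) (val x).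
  apply: near_coords_trans c1; apply: near_coords_sym; apply: near_coordsW c12; first by lia.
  by apply/ltW/NE => /=; lia.
rewrite -splitr in c2; rewrite [e]splitr.
apply: (@near2pi_sub_trans _ _ _ _ (phi x)).
  by apply: dU; apply: near_coordsW c1; rewrite // ler_pdivrMr //; lra.
exact/near2pi_sub_sym/dU.
Qed.

(** * Lifting functions on the line *)

(** The increments of b have small representatives modulo 2 pi; P adds them
    up. *)
Lemma lift_int_sequence (R : realType) (b : int -> R) (e : R) :
  (forall m, near2pi e (b (m + 1) - b m)) ->
  exists P : int -> R, (forall m, int2pi (P m - b m)) /\
    forall m, `|P (m + 1) - P m| < e.
Proof.
move=> nb; have /choice[d dP] m : exists d, int2pi (d - (b (m + 1) - b m)) /\ `|d| < e.
  by have [d] := near2pi_repr (nb m); exists d.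
pose P m : R := match m with
  | Posz n => b 0 + \sum_(i < n) d (Posz i)
  | Negz n => b 0 - \sum_(i < n.+1) d (Negz i) end.
have PS m : P (m + 1) - P m = d m.
  case: m => [n|[|n]].
  - by rewrite -PoszD addn1 /P big_ord_recr /=; ring.
  - rewrite (_ : Negz 0 + 1 = 0%N) // /P big_ord0 big_ord_recr big_ord0 /=; ring.
  - rewrite (_ : Negz n.+1 + 1 = Negz n); last by lia.
    by rewrite /P [in X in _ - X]big_ord_recr /=; ring.
exists P; split=> [|m]; last by rewrite PS; have [] := dP m.
have up m : int2pi (P m - b m) -> int2pi (P (m + 1) - b (m + 1)).
  have [+ _] := dP m; rewrite -PS => /int2piD /[apply].
  by congr int2pi; ring.
have down m : int2pi (P (m + 1) - b (m + 1)) -> int2pi (P m - b m).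
  have [+ _] := dP m; rewrite -PS => /int2piN /int2piD /[apply].
  by congr int2pi; ring.
have P0 : int2pi (P 0 - b 0).
  by rewrite (_ : P 0 = b 0) ?subrr; [exact: int2pi0|rewrite /P /= big_ord0 addr0].
case=> n.
  by elim: n => // n; rewrite -addn1 PoszD; exact: up.
elim: n => [|n ih]; apply: down.
  by rewrite (_ : Negz 0 + 1 = 0).
by rewrite (_ : Negz n.+1 + 1 = Negz n) //; lia.
Qed.

(** Lifting to R a circle-valued function on the line: sample it with step h,
    lift the samples, and correct between the samples by a small representative
    of the increment. *)
Lemma lift_line (R : realType) (a : R -> R) (h : R) : 0 < h ->
  (forall s t, `|s - t| <= h -> near2pi (pi / 3) (a s - a t)) ->
  exists psi : R -> R, (forall t, int2pi (psi t - a t)) /\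
    forall s t, `|s - t| <= h -> `|psi s - psi t| < pi / 3.
Proof.
move=> h0 na; have pi0 := pi_gt0 R.
have [|P [Pa Pstep]] := @lift_int_sequence R (fun m => a (m%:~R * h)) (pi / 3).
  move=> m; apply: na; rewrite -mulrBl intrD mulr1z addrC addKr mul1r.
  by rewrite gtr0_norm.
pose m t := Num.floor (t / h).
have mt t : 0 <= t - (m t)%:~R * h < h.
  have := Num.Theory.floor_le (t / h); have := floorD1_gt (t / h).
  by rewrite -/(m t) intrD mulr1z ltr_pdivrMr // ler_pdivlMr // mulrDl mul1r; lra.
have /choice[c cP] t : exists c,
    int2pi (c - (a t - a ((m t)%:~R * h))) /\ `|c| < pi / 3.
  have [|c c1 c2] := @near2pi_repr R (pi / 3) (a t - a ((m t)%:~R * h)); last by exists c.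
  apply: na; have := mt t; rewrite ler_norml; lra.
exists (fun t => P (m t) + c t); have Pca t : int2pi (P (m t) + c t - a t).
  have [+ _] := cP t; move=> /(int2piD (Pa (m t))).
  by congr int2pi; ring.
split=> // s t; wlog st : s t / s <= t => [wl|] sth.
  have [st|/ltW ts] := leP s t; first exact: wl.
  by rewrite distrC; apply: wl; rewrite // distrC.
have e : near2pi (pi / 3) (P (m s) + c s - (P (m t) + c t)).
  apply: near2pi_int2pi (na _ _ sth).
  have := int2piB (Pca t) (Pca s); congr int2pi; ring.
apply: near2pi_norm_lt e _.
(* s and t lie in the same sampling interval or in consecutive ones. *)
have Pst : `|P (m s) - P (m t)| <= pi / 3.
  have [mst|mst] : m s = m t \/ m t = m s + 1.
    have := mt s; have := mt t.
    move: sth; rewrite ler_norml => sth ht hs.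
    have l1 : (m s)%:~R < (m t)%:~R + 1 :> R.
      rewrite -(ltr_pM2r h0) mulrDl mul1r; lra.
    have l2 : (m t)%:~R < (m s)%:~R + 2 :> R.
      rewrite -(ltr_pM2r h0) [(_ + 2) * h]mulrDl; lra.
    move: l1 l2; rewrite -[1]/(1%:~R) -[2]/(2%:~R) -!intrD !ltr_int; lia.
  - by rewrite mst subrr normr0 divr_ge0 // ltW.
  - by rewrite mst distrC ltW.
have [_ cs] := cP s; have [_ ct] := cP t.
rewrite opprD addrACA; apply: le_trans (ler_normD _ _) _.
have := ler_normB (c s) (c t); lra.
Qed.

Lemma bound_by_steps (R : realType) (psi : R -> R) (h c : R) : 0 < h ->
  (forall s t, `|s - t| <= h -> `|psi s - psi t| <= c) ->
  forall n s t, `|s - t| <= n%:R * h -> `|psi s - psi t| <= n%:R * c.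
Proof.
move=> h0 step; elim=> [|n ihn] s t.
  by rewrite !mul0r normr_le0 subr_eq0 => /eqP ->; rewrite subrr normr0.
move=> st; pose r := t + (s - t) * (n%:R / n.+1%:R).
have n10 : 0 < n.+1%:R :> R by rewrite ltr0n.
have sr : `|s - r| <= h.
  have -> : s - r = (s - t) / n.+1%:R.
    by rewrite /r -natr1; field; rewrite natr1 gt_eqF.
  by rewrite normrM [X in _ * X]gtr0_norm ?invr_gt0 // ler_pdivrMr // mulrC.
have rt : `|r - t| <= n%:R * h.
  rewrite /r addrC addKr normrM [X in _ * X]ger0_norm ?divr_ge0 //.
  have -> : n%:R * h = n.+1%:R * h * (n%:R / n.+1%:R) by field; rewrite gt_eqF.
  by rewrite ler_wpM2r ?divr_ge0.
have -> : psi s - psi t = (psi s - psi r) + (psi r - psi t) by ring.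
apply: le_trans (ler_normD _ _) _; rewrite -natr1 mulrDl mul1r addrC.
by apply: lerD; [exact: ihn|exact: step].
Qed.

Lemma reach_by_steps (R : realType) (h : R) (Q : R -> Prop) : 0 < h ->
  (forall s t, `|s - t| <= h -> Q s -> Q t) -> Q 0 -> forall t, Q t.
Proof.
move=> h0 step Q0 t.
have reach n : forall t, `|t| <= n%:R * h -> Q t.
  elim: n => [|n ihn] {}t tn.
    by move: tn; rewrite mul0r normr_le0 => /eqP ->.
  have n10 : 0 < n.+1%:R :> R by rewrite ltr0n.
  apply: (step (t * (n%:R / n.+1%:R))); last first.
    apply: ihn; rewrite normrM [X in _ * X]ger0_norm ?divr_ge0 //.
    have -> : n%:R * h = n.+1%:R * h * (n%:R / n.+1%:R) by field; rewrite gt_eqF.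
    by rewrite ler_wpM2r ?divr_ge0.
  have -> : t * (n%:R / n.+1%:R) - t = - (t / n.+1%:R).
    by rewrite -natr1; field; rewrite natr1 gt_eqF.
  rewrite normrN normrM [X in _ * X]gtr0_norm ?invr_gt0 //.
  by rewrite ler_pdivrMr // mulrC.
apply: (reach (Num.bound (`|t| / h))); rewrite -ler_pdivrMr //.
by apply/ltW/archi_boundP; rewrite divr_ge0 // ltW.
Qed.

(** * Bohr sets *)

Definition bohr_set (R : realType) (w : nat -> R) (n : nat) (d : R) (tau : R) : Prop :=
  forall j, (j < n)%N -> near2pi d (w j * tau).

Lemma bohr_orbit_point (R : realType) (w : nat -> R) n d s t :
  near_coords n d (val (orbit_point w s)) (val (orbit_point w t)) <->
  bohr_set w n d (s - t).
Proof.
split=> H j /H; apply: near2pi_int2pi; first exact: orbit_point_diff.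
by rewrite -opprB; exact/int2piN/orbit_point_diff.
Qed.

Lemma bohr_small (R : realType) (w : nat -> R) n (d : R) : 0 < d ->
  exists2 h, 0 < h & forall tau, `|tau| <= h -> bohr_set w n d tau.
Proof.
move=> d0; elim: n => [|n [h h0 hb]]; first by exists 1.
pose h' := d / (2 * (`|w n| + 1)).
have w0 : 0 < `|w n| + 1 by rewrite ltr_pwDr.
have h'0 : 0 < h' by rewrite divr_gt0 ?mulr_gt0.
exists (Num.min h h'); first by rewrite lt_min h0 h'0.
move=> tau; rewrite le_min => /andP[th th'] j.
rewrite ltnS leq_eqVlt => /orP[/eqP ->|]; last exact: hb.
apply: near2pi_norm; rewrite normrM.
apply: (@le_lt_trans _ _ ((`|w n| + 1) * h')).
  by apply: ler_pM => //; rewrite lerDl.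
rewrite /h' (_ : (`|w n| + 1) * _ = d / 2); first by rewrite ltr_pdivrMr //; lra.
by field; rewrite gt_eqF.
Qed.

(** If each s_m were at distance more than m from the Bohr set, the points of
    the orbit at the times s_m would cluster somewhere.  Fix s_p near the
    cluster point: for some large m the difference s_m - s_p belongs to the Bohr
    set, and its distance to s_m is only |s_p|. *)
Lemma bohr_relatively_dense (R : realType) (w : nat -> R) n (d : R) : 0 < d ->
  exists l, forall s, exists2 tau, bohr_set w n d tau & `|s - tau| <= l.
Proof.
move=> d0; apply: contrapT => sparse.
have /choice[s sP] m : exists s, forall tau, bohr_set w n d tau -> m%:R < `|s - tau|.
  apply: contrapT => ns; apply: sparse; exists m%:R => s.
  apply: contrapT => nt; apply: ns; exists s => tau bt.
  by rewrite ltNge; apply/negP => st; apply: nt; exists tau.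
have [x xP] := hull_cluster (fun m => orbit_point w (s m)).
have d20 : 0 < d / 2 by rewrite divr_gt0.
have [p _ cp] := xP n (d / 2) 0%N d20.
have [m pm cm] := xP n (d / 2) (Num.bound `|s p|) d20.
have := near_coords_trans cm (near_coords_sym cp).
rewrite -splitr => /bohr_orbit_point /(sP m); rewrite ltNge => /negP; apply.
rewrite opprB addrC subrK; apply: le_trans (ltW (archi_boundP (normr_ge0 _))) _.
by rewrite ler_nat.
Qed.

(** The integers a such that lam a lies in the module form a subgroup of Z
    that does not contain 1, hence it is contained in N Z for some N > 1. *)
Lemma index_of_notin (R : realType) (w : nat -> R) (lam : R) :
  lam \notin freq_module w ->
  exists2 N : nat, (1 < N)%N & forall a : int, lam *~ a \in freq_module w ->
    exists b : int, a = N%:Z * b.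
Proof.
move=> lamN.
have absM (a : int) : lam *~ a \in freq_module w -> lam *+ `|a|%N \in freq_module w.
  case: a => n //=; rewrite NegzE mulrNz rpredN //.
have [[n0 n0P]|none] := pselect (exists n, (0 < n)%N && (lam *+ n \in freq_module w)).
  have [N /andP[N0 NM] Nmin] :=
    ex_minnP (ex_intro (fun n => (0 < n)%N && (lam *+ n \in freq_module w)) n0 n0P).
  exists N => [|a aM].
    by case: N N0 NM {Nmin} => [|[|N]] //; rewrite mulr1n (negbTE lamN).
  exists (divz a N); rewrite mulrC.
  have Nz : (N : int) != 0 by lia.
  have r0 := modz_ge0 a Nz; have rN : (modz a N < N)%R by rewrite ltz_pmod.
  suff rz : modz a N = 0 by rewrite {1}(divz_eq a N) rz addr0.
  have rM : lam *+ `|modz a N|%N \in freq_module w.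
    apply: absM.
    have -> : modz a N = a - divz a N * N by rewrite {2}(divz_eq a N) addrC addKr.
    rewrite mulrzBr rpredB // mulrC mulrzA.
    by rewrite rpredMz // -pmulrn.
  apply/eqP; apply: contraT => rn0.
  have /Nmin : (0 < `|modz a N|)%N && (lam *+ `|modz a N|%N \in freq_module w).
    by rewrite rM andbT; lia.
  lia.
exists 2%N => // a aM; exists 0; rewrite mulr0.
apply: contrapT => a0; apply: none; exists `|a|%N.
by rewrite absM // andbT; lia.
Qed.

(** Suppose that lam is not in the module.  With N as in the previous lemma,
    the value xi = 2 pi floor (N / 2) / N is compatible with all the relations
    between lam and the w.  By Kronecker's theorem some t in the Bohr set makes
    lam t close to xi, which is at distance at least 2 pi / 3 from the multiples
    of 2 pi. *)
Lemma freq_module_of_bohr (R : realType) (w : nat -> R) (lam : R) n (d : R) : 0 < d ->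
  (forall tau, bohr_set w n d tau -> near2pi (pi / 3) (lam * tau)) ->
  lam \in freq_module w.
Proof.
move=> d0 near; apply: contraT => /index_of_notin[N N1 NP].
have pi0 := pi_gt0 R.
pose xi : R := 2 * pi * (N./2)%:R / N%:R.
(* lam becomes the coordinate of index 0 and the w are shifted. *)
pose W j := if j is j'.+1 then w j' else lam.
pose x j := if j is j'.+1 then 0 else xi.
have N0 : 0 < N%:R :> R by rewrite ltr0n; lia.
have compat L : intform L -> L W = 0 -> int2pi (L x).
  move=> /intform_split_head[a [M [fM LE]]]; rewrite !LE /=.
  move=> /eqP; rewrite addr_eq0 => /eqP aM.
  have [b ->] : exists b : int, a = N%:Z * b.
    by apply: NP; rewrite aM rpredN; apply/freq_moduleP; exists M.
  have -> : M (fun=> 0) = 0 by have := intformZ 0 (fun=> 0) fM; rewrite !mul0r.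
  exists ((N./2)%:Z * b); rewrite addr0 -mulrzr !intrM /xi /=.
  by rewrite -!pmulrn; field; rewrite gt_eqF.
pose e := Num.min d (pi / 3).
have e0 : 0 < e by rewrite lt_min d0 divr_gt0.
have [t tP] := kronecker compat n.+1 e0.
have : near2pi (pi / 3) (lam * t).
  apply: near => j jn; have := tP j.+1 jn; rewrite subr0.
  by apply: near2piW; rewrite ge_min lexx.
move=> /(near2piD (near2piN (tP 0%N isT))) /=; rewrite opprB subrK => nxi.
have : near2pi (2 * pi / 3) xi.
  apply: near2piW nxi.
  have : e <= pi / 3 by rewrite ge_min lexx orbT.
  lra.
have lo : 2 * pi / 3 <= xi.
  rewrite /xi ler_pdivlMr //.
  have : N%:R <= (3 * N./2)%:R :> R by rewrite ler_nat; lia.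
  by rewrite natrM -(ler_pM2l pi0); lra.
have hi : xi <= pi.
  rewrite /xi ler_pdivrMr //.
  have : (2 * N./2)%:R <= N%:R :> R by rewrite ler_nat; lia.
  by rewrite natrM -(ler_pM2l pi0); lra.
move=> /near2pi_norm_lt; rewrite ger0_norm; last by lra.
have -> : xi <= 2 * pi - 2 * pi / 3 by lra.
by move=> /(_ isT); rewrite ltNge lo.
Qed.

(** * The argument of an almost periodic function *)

(** For n, m > 0, comparing q (n m) with m q (n) and with n q (m) shows that
    (q (n) - D) / n is at most (q (m) + D) / m.  Any number between the two
    families is a slope; the supremum of the former is one. *)
Lemma quasimorphism_slope (R : realType) (q : R -> R) (D : R) :
  (forall s t, `|q (s + t) - q s - q t| <= D) ->
  (forall s t, `|s - t| <= 1 -> `|q s - q t| <= D) ->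
  exists lam B, forall t, `|q t - lam * t| <= B.
Proof.
move=> qD q1.
have D0 : 0 <= D by apply: le_trans (normr_ge0 _) (qD 0 0).
have mult n t : `|q (n.+1%:R * t) - n.+1%:R * q t| <= n%:R * D.
  elim: n => [|n ih]; first by rewrite !mul1r subrr normr0 mul0r.
  have -> : q (n.+2%:R * t) - n.+2%:R * q t =
    (q (n.+1%:R * t + t) - q (n.+1%:R * t) - q t) + (q (n.+1%:R * t) - n.+1%:R * q t).
    by rewrite -(@natr1 R n.+1) mulrDl mul1r; ring.
  have -> : n.+1%:R * D = D + n%:R * D by rewrite -natr1; ring.
  by apply: le_trans (ler_normD _ _) _; exact: lerD.
have cross n m : (q n.+1%:R - D) / n.+1%:R <= (q m.+1%:R + D) / m.+1%:R.
  rewrite ler_pdivrMr ?ltr0n // mulrAC ler_pdivlMr ?ltr0n //.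
  have := mult m n.+1%:R; have := mult n m.+1%:R.
  rewrite [m.+1%:R * n.+1%:R]mulrC !ler_norml => /andP[a1 a2] /andP[a3 a4].
  have : n.+1%:R * D = n%:R * D + D by rewrite -natr1; ring.
  have : m.+1%:R * D = m%:R * D + D by rewrite -(@natr1 R m); ring.
  by lra.
pose S := [set (q n.+1%:R - D) / n.+1%:R | n in [set: nat]].
have supS : has_sup S.
  split; first by exists ((q 1%:R - D) / 1%:R), 0%N.
  by exists ((q 1%:R + D) / 1%:R) => _ [n _ <-]; exact: cross.
pose lam := sup S.
have nat_bound n : `|q n.+1%:R - lam * n.+1%:R| <= D.
  have lo : (q n.+1%:R - D) / n.+1%:R <= lam by apply: ub_le_sup; [exact: supS.2|exists n].
  have hi : lam <= (q n.+1%:R + D) / n.+1%:R.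
    by apply: ge_sup; [exact: supS.1|move=> _ [m _ <-]; exact: cross].
  move: lo hi; rewrite ler_pdivrMr ?ltr0n // ler_pdivlMr ?ltr0n // ler_norml; lra.
have pos_bound t : 0 <= t -> `|q t - lam * t| <= 2 * D + `|lam|.
  move=> t0; pose n := Num.trunc t.
  have /andP[tn1 tn2] : n%:R <= t < n.+1%:R by exact: Num.Theory.truncn_itv.
  have nt : `|t - n.+1%:R| <= 1 by rewrite ler_norml -natr1 in tn2 *; lra.
  (* n + 1 rather than n keeps the integer positive. *)
  have -> : q t - lam * t = (q t - q n.+1%:R) + (q n.+1%:R - lam * n.+1%:R)
     - lam * (t - n.+1%:R) by ring.
  apply: le_trans (ler_normB _ _) _; apply: lerD.
    rewrite mulrDl mul1r; apply: le_trans (ler_normD _ _) _.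
    by apply: lerD; [exact: q1|exact: nat_bound].
  by rewrite normrM ler_piMr.
exists lam, (4 * D + `|lam|) => t.
have [t0|t0] := leP 0 t; first by apply: le_trans (pos_bound t t0) _; lra.
have := pos_bound (- t); rewrite oppr_ge0 => /(_ (ltW t0)).
have := qD t (- t); have := qD 0 0; rewrite subrr addr0.
rewrite !ler_norml mulrN; lra.
Qed.

(** The number k of turns is locally constant in t, since it can only change by
    a jump of size 2 pi, larger than the variation of psi over a step. *)
Lemma common_turns (R : realType) (psi : R -> R) (h e tau : R) :
  0 < h -> e <= pi / 3 ->
  (forall s t, `|s - t| <= h -> `|psi s - psi t| < pi / 3) ->
  (forall t, near2pi e (psi (t + tau) - psi t)) ->
  exists k : int, forall t, `|psi (t + tau) - psi t - k%:~R * (2 * pi)| < e.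
Proof.
move=> h0 e3 step near; have [k k0] := near 0; exists k.
have pi0 := pi_gt0 R.
apply: reach_by_steps h0 _ k0 => s t st ks.
apply: near2pi_norm_lt.
  apply: near2pi_int2pi (near t); exists k; ring.
have s1 := step _ _ st.
have s2 : `|psi (s + tau) - psi (t + tau)| < pi / 3.
  by apply: step; rewrite opprD addrACA subrr addr0.
move: ks s1 s2; rewrite !ltr_norml ler_norml; lra.
Qed.

(** After m translations by tau the error has accumulated to m c up to m e, but
    it remains at most 2 B. *)
Lemma drift_le (R : realType) (u : R -> R) (tau c e B : R) :
  (forall t, `|u t| <= B) -> (forall t, `|u (t + tau) - u t - c| <= e) ->
  `|c| <= e.
Proof.
move=> uB ue; rewrite leNgt; apply/negP => ec.
have iter m : `|u (m%:R * tau) - u 0 - m%:R * c| <= m%:R * e.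
  elim: m => [|m ihm]; first by rewrite !mul0r subrr subr0 normr0.
  have -> : u (m.+1%:R * tau) - u 0 - m.+1%:R * c =
     (u (m%:R * tau + tau) - u (m%:R * tau) - c) + (u (m%:R * tau) - u 0 - m%:R * c).
    by rewrite -natr1 [(_ + 1) * tau]mulrDl mul1r; ring.
  have -> : m.+1%:R * e = e + m%:R * e by rewrite -natr1; ring.
  by apply: le_trans (ler_normD _ _) _; exact: lerD.
have B0 : 0 <= B by apply: le_trans (normr_ge0 _) (uB 0).
pose m := Num.bound (2 * B / (`|c| - e)).
have : 2 * B / (`|c| - e) < m%:R.
  by apply: archi_boundP; rewrite divr_ge0 ?mulr_ge0 // subr_ge0 ltW.
rewrite ltr_pdivrMr ?subr_gt0 // => mbig.
have mc : `|m%:R * c| = m%:R * `|c| by rewrite normrM ger0_norm.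
have := ler_normB (u (m%:R * tau) - u 0) (u (m%:R * tau) - u 0 - m%:R * c).
rewrite opprB addrC subrK mc.
have := ler_normB (u (m%:R * tau)) (u 0).
have := uB (m%:R * tau); have := uB 0; have := iter m; lra.
Qed.

(** Bohr's theorem: psi has a mean slope, the slope belongs to the frequency
    module, and the remainder is almost periodic. *)
Theorem bohr_argument (R : realType) (w : nat -> R) (psi : R -> R) (h : R) :
  0 < h -> (forall s t, `|s - t| <= h -> `|psi s - psi t| < pi / 3) ->
  (forall e, 0 < e -> exists n d, 0 < d /\
    forall tau, bohr_set w n d tau -> forall t, near2pi e (psi (t + tau) - psi t)) ->
  exists2 L, intform L &
    forall e, 0 < e -> exists n d, 0 < d /\
      forall tau, bohr_set w n d tau ->
      forall t, `|psi (t + tau) - psi t - L w * tau| < e.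
Proof.
move=> h0 step near; have pi0 := pi_gt0 R; have pi30 : 0 < pi / 3 :> R by rewrite divr_gt0.
have local l : exists C, forall s t, `|s - t| <= l -> `|psi s - psi t| <= C.
  exists ((Num.bound (`|l| / h))%:R * (pi / 3)) => s t st.
  apply: (bound_by_steps h0 (fun s' t' st' => ltW (step s' t' st'))).
  apply: le_trans st _; apply: le_trans (ler_norm _) _.
  rewrite -ler_pdivrMr //; apply/ltW/archi_boundP.
  by rewrite divr_ge0 // ltW.
have [lam [B psiB]] : exists lam B, forall t, `|psi t - lam * t| <= B.
  have [n [d [d0 nd]]] := near _ pi30.
  have [l ld] := bohr_relatively_dense w n d0.
  have [C lC] := local l; have [C1 lC1] := local 1.
  have [||lam [B qB]] := @quasimorphism_slope R (fun t => psi t - psi 0)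
      (2 * `|C| + `|C1| + pi).
  (* Replace the increment s by a nearby tau of the Bohr set, along which psi
     grows by the same multiple of 2 pi from 0 and from t. *)
  - move=> s t; have [tau btau stau] := ld s.
    have [k kP] := common_turns h0 (lexx _) step (nd _ btau).
    have s1 : `|psi (s + t) - psi (t + tau)| <= C.
      by apply: lC; rewrite (_ : _ - _ = s - tau) //; ring.
    have s2 := lC _ _ stau; have k1 := kP t; have k0 := kP 0.
    have C2 := ler_norm C; have := normr_ge0 C1.
    rewrite add0r in k0; move: s1 s2 k1 k0.
    rewrite !ltr_norml !ler_norml; lra.
  - move=> s t st; have := lC1 _ _ st; have := ler_norm C1; have := normr_ge0 C.
    rewrite (_ : psi s - _ - _ = psi s - psi t); last by ring.
    lra.
  exists lam, (B + `|psi 0|) => t.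
  have -> : psi t - lam * t = (psi t - psi 0 - lam * t) + psi 0 by ring.
  by apply: le_trans (ler_normD _ _) _; rewrite lerD2r.
have slope e : 0 < e -> e <= pi / 3 -> exists n d, 0 < d /\
    forall tau, bohr_set w n d tau -> near2pi e (lam * tau) /\
      forall t, `|psi (t + tau) - psi t - lam * tau| < e.
  move=> e0 e3; have e30 : 0 < e / 3 by rewrite divr_gt0.
  have [n [d [d0 nd]]] := near _ e30.
  exists n, d; split => // tau /nd btau.
  have [|k kP] := common_turns h0 _ step btau; first by lra.
  (* psi t - lam t is bounded, and a translation by tau adds 2 pi k - lam tau to
     it, up to e / 3. *)
  have c3 : `|k%:~R * (2 * pi) - lam * tau| <= e / 3.
    apply: (@drift_le R (fun t => psi t - lam * t) tau _ _ B) => // t.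
    rewrite (_ : _ - _ = psi (t + tau) - psi t - k%:~R * (2 * pi)).
      exact: ltW.
    by ring.
  split=> [|t].
    by exists k; rewrite distrC; lra.
  have := kP t; move: c3; rewrite !ltr_norml !ler_norml; lra.
have lamM : lam \in freq_module w.
  have [n [d [d0 nd]]] := slope _ pi30 (lexx _).
  by apply: freq_module_of_bohr d0 _ => tau /nd[].
have /freq_moduleP[L fL lamE] := lamM; exists L => // e e0.
pose e' := Num.min e (pi / 3).
have [||n [d [d0 nd]]] := slope e'; first by rewrite lt_min e0.
  by rewrite ge_min lexx orbT.
exists n, d; split => // tau /nd[_ +] t => /(_ t); rewrite lamE => /lt_le_trans; apply.
by rewrite ge_min lexx.
Qed.

(** * Circle-valued maps on the closure *)

(** At x, choose among the representatives of phi x modulo 2 pi the one which is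
    close to the values of v at the times when the orbit is close to x.  The
    variation of v along Bohr sets shows that the choice oscillates by less
    than pi. *)
Lemma hull_extension (R : realType) (w : nat -> R) (phi : set_type (hull w) -> R)
    (v : R -> R) :
  contmod phi -> (forall t, int2pi (v t - phi (orbit_point w t))) ->
  (exists n d, 0 < d /\ forall tau, bohr_set w n d tau ->
     forall t, `|v (t + tau) - v t| < pi / 4) ->
  exists2 u : set_type (hull w) -> R, continuous u & forall x, int2pi (u x - phi x).
Proof.
move=> cphi vphi [n1 [d1 [d10 vd]]]; have pi0 := pi_gt0 R.
have pi40 : 0 < pi / 4 :> R by rewrite divr_gt0.
have [n2 [d2 [d20 phid]]] := hull_unif_contmod cphi pi40.
pose n := maxn n1 n2; pose d := Num.min d1 d2.
have d0 : 0 < d by rewrite lt_min d10.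
have d30 : 0 < d / 3 by rewrite divr_gt0.
have /choice[T TP] := fun x : set_type (hull w) => orbit_point_dense x n d30.
have /choice[c cP] x : exists c,
    int2pi (c - (phi x - phi (orbit_point w (T x)))) /\ `|c| < pi / 4.
  have [|c c1 c2] := @near2pi_repr R (pi / 4) (phi x - phi (orbit_point w (T x)));
    last by exists c.
  apply/near2pi_sub_sym/phid; apply: near_coordsW (TP x); first exact: leq_maxr.
  have : d <= d2 by rewrite ge_min lexx orbT.
  lra.
pose u x := v (T x) + c x.
have uphi x : int2pi (u x - phi x).
  have [cx _] := cP x.
  by have := int2piD cx (vphi (T x)); congr int2pi; rewrite /u; ring.
exists u => //; apply: contmod_small_osc; first exact: contmod_int2pi uphi cphi.
move=> x; apply: filterS (hull_nbhs_near_coords x n d30) => y yx.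
(* T x and T y are times when the orbit is close to x and to y. *)
have b : bohr_set w n d (T y - T x).
  apply/bohr_orbit_point.
  have := near_coords_trans (near_coords_trans (TP y) yx) (near_coords_sym (TP x)).
  by congr near_coords; field.
have vxy : `|v (T y) - v (T x)| < pi / 4.
  have -> : T y = T x + (T y - T x) by ring.
  apply: vd => j jn; apply: near2piW (b j _); first by rewrite ge_min lexx.
  by rewrite leq_max jn.
have [_ cx] := cP x; have [_ cy] := cP y.
by move: vxy cx cy; rewrite /u !ltr_norml; lra.
Qed.

(** The Bruschlinsky-Eilenberg description of circle-valued maps for X: up to a
    map that lifts to R, each of them is the character of an integral form. *)
Theorem hull_character (R : realType) (w : nat -> R) (phi : set_type (hull w) -> R) :
  contmod phi ->
  exists L, exists2 u : set_type (hull w) -> R, intform L /\ continuous u &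
    forall x, int2pi (phi x - L (fun j => torus_lift (val x j)) - u x).
Proof.
move=> cphi; have pi0 := pi_gt0 R; have pi30 : 0 < pi / 3 :> R by rewrite divr_gt0.
have along e : 0 < e -> exists n d, 0 < d /\ forall s t, bohr_set w n d (s - t) ->
    near2pi e (phi (orbit_point w s) - phi (orbit_point w t)).
  move=> e0; have [n [d [d0 nd]]] := hull_unif_contmod cphi e0.
  by exists n, d; split => // s t /bohr_orbit_point /nd.
have [n [d [d0 nd]]] := along _ pi30.
have [h h0 hb] := bohr_small w n d0.
have [|psi [psiphi step]] := @lift_line R (fun t => phi (orbit_point w t)) h h0.
  by move=> s t /hb /nd.
have [L fL LP] : exists2 L, intform L & forall e, 0 < e -> exists n d, 0 < d /\
      forall tau, bohr_set w n d tau ->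
      forall t, `|psi (t + tau) - psi t - L w * tau| < e.
  apply: bohr_argument h0 step _ => e e0.
  have [n' [d' [d'0 nd']]] := along _ e0.
  exists n', d'; split => // tau btau t.
  have tt : t + tau - t = tau by ring.
  have := nd' (t + tau) t; rewrite tt => /(_ btau); apply: near2pi_int2pi.
  by have := int2piB (psiphi t) (psiphi (t + tau)); congr int2pi; ring.
pose chi (x : set_type (hull w)) := L (fun j => torus_lift (val x j)).
have [|||u cu uP] := @hull_extension R w (fun x => phi x - chi x)
    (fun t => psi t - L w * t).
- by apply: contmodB => //; exact: contmod_val_intform.
- move=> t; have := int2piD (psiphi t) (intform_orbit_point w t fL).
  by congr int2pi; rewrite /chi; ring.
- have pi40 : 0 < pi / 4 :> R by rewrite divr_gt0.
  have [n' [d' [d'0 nd']]] := LP _ pi40.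
  exists n', d'; split => // tau /nd' + t => /(_ t).
  by congr (`|_| < _); ring.
exists L, u => // x; have := int2piN (uP x); congr int2pi; rewrite /chi; ring.
Qed.

(** By the intermediate value theorem, a continuous function on the line with
    values in a discrete set is constant. *)
Lemma continuous_int2pi_const (R : realType) (d : R -> R) :
  continuous d -> (forall t, int2pi (d t)) -> forall s t, d s = d t.
Proof.
move=> cd d2pi; have pi0 := pi_gt0 R.
suff le s t : s <= t -> d s = d t.
  by move=> s t; have [/le|/ltW/le] := leP s t.
move=> st; apply: contrapT => dst.
wlog dlt : d cd d2pi dst / d s < d t => [wl|].
  have [lt|gt|//] := ltgtP (d s) (d t); first exact: (wl d).
  apply: (wl (fun t => - d t)) => [t'|t'||]; rewrite ?ltrN2 //.
  - by apply: cvgN; exact: cd.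
  - by apply: int2piN.
  by move=> /oppr_inj.
have gap : 2 * pi <= d t - d s.
  rewrite leNgt; apply/negP => small.
  have := int2pi_eq0 (int2piB (d2pi t) (d2pi s)).
  rewrite gtr0_norm ?subr_gt0 // => /(_ small) /eqP.
  by rewrite subr_eq0 => /eqP e; move: dlt; rewrite e ltxx.
have [||c _ dc] := @IVT R d s t (d s + pi) st.
- exact: continuous_subspaceT.
- by rewrite min_l ?max_r; lra.
have := int2pi_eq0 (int2piB (d2pi c) (d2pi s)).
rewrite dc addrC addKr gtr0_norm // => /(_ _) p0.
have : pi < 2 * pi :> R by lra.
by move=> /p0 pe; move: pi0; rewrite pe ltxx.
Qed.

(** Along the orbit the character of L turns by L(w) t, while a lift on a
    compact space is bounded. *)
Lemma hull_character_unique (R : realType) (w : nat -> R) (L : (nat -> R) -> R)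
    (u : set_type (hull w) -> R) :
  intform L -> continuous u ->
  (forall x, int2pi (L (fun j => torus_lift (val x j)) - u x)) -> L w = 0.
Proof.
move=> fL cu Lu; have [B uB] := hull_bounded cu.
pose d t := L w * t - u (orbit_point w t).
have cd : continuous d.
  move=> t; apply: cvgB; first by apply: cvgMr; exact: cvg_id.
  by apply: continuous_comp; [exact: continuous_orbit_point|exact: cu].
have d2pi t : int2pi (d t).
  have := int2piB (Lu (orbit_point w t)) (intform_orbit_point w t fL).
  by congr int2pi; rewrite /d; ring.
have dc := continuous_int2pi_const cd d2pi.
have B0 : 0 <= B by apply: le_trans (normr_ge0 _) (uB (orbit_point w 0)).
apply/eqP; rewrite -normr_le0 leNgt; apply/negP => Lw0.
pose m := Num.bound (2 * B / `|L w|).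
have : 2 * B / `|L w| < m%:R by apply: archi_boundP; rewrite divr_ge0 ?mulr_ge0.
rewrite ltr_pdivrMr // => mbig.
have := dc m%:R 0; rewrite /d mulr0 sub0r => dE.
have : `|L w * m%:R| = `|u (orbit_point w m%:R) - u (orbit_point w 0)|.
  by congr (`|_|); lra.
rewrite normrM [X in _ * X]ger0_norm // mulrC => mE.
have := ler_normB (u (orbit_point w m%:R)) (u (orbit_point w 0)).
have := uB (orbit_point w m%:R); have := uB (orbit_point w 0); lra.
Qed.

(** * Homeomorphic closures have isomorphic modules *)

(** A subgroup of the product which is total, surjective, and has trivial
    kernels on both sides is the graph of an isomorphism. *)
Lemma zmod_isomorphic_of_rel (U V : zmodType) (r : U -> V -> Prop) :
  (forall x, exists y, r x y) -> (forall y, exists x, r x y) ->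
  (forall x y x' y', r x y -> r x' y' -> r (x - x') (y - y')) ->
  (forall y, r 0 y -> y = 0) -> (forall x, r x 0 -> x = 0) ->
  zmod_isomorphic U V.
Proof.
move=> rtot rsurj rB r0l r0r.
have fun_r x y y' : r x y -> r x y' -> y = y'.
  by move=> xy xy'; apply/eqP; rewrite -subr_eq0; apply/eqP/r0l;
    have := rB _ _ _ _ xy xy'; rewrite subrr.
have inj_r x x' y : r x y -> r x' y -> x = x'.
  by move=> xy xy'; apply/eqP; rewrite -subr_eq0; apply/eqP/r0r;
    have := rB _ _ _ _ xy xy'; rewrite subrr.
have [f fP] := choice rtot; have [g gP] := choice rsurj.
have fB : zmod_morphism f.
  by move=> x y; apply: fun_r (fP _) _; exact: rB.
pose F : {additive U -> V} := HB.pack f (GRing.isZmodMorphism.Build U V f fB).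
exists F, g => [x|y]; first by apply: inj_r (gP _) _; exact: fP.
by apply: fun_r (fP _) _; exact: gP.
Qed.

(** Two frequencies correspond when their characters agree, through the
    homeomorphism, up to a map that lifts to R.  Existence of a correspondent
    on both sides is [hull_character]; both kernels are trivial by
    [hull_character_unique]. *)
Lemma homeomorphic_iso (R : realType) (w w' : nat -> R) :
  homeomorphic (set_type (hull w)) (set_type (hull w')) ->
  zmod_isomorphic (freq_group w) (freq_group w').
Proof.
move=> [f [g [cf cg fg gf]]].
pose chi u (L : (nat -> R) -> R) (x : set_type (hull u)) :=
  L (fun j => torus_lift (val x j)).
pose r (m : freq_group w) (m' : freq_group w') :=
  exists (L L' : (nat -> R) -> R) (u : set_type (hull w') -> R),
  [/\ intform L /\ val m = L w, intform L' /\ val m' = L' w', continuous u &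
    forall x : set_type (hull w'), int2pi (chi w L (g x) - chi w' L' x - u x)].
have cchi u L : intform L -> contmod (chi u L) by exact: contmod_val_intform.
have elt (u : nat -> R) L : intform L -> exists m : freq_group u, val m = L u.
  move=> fL; have mL : L u \in freq_module u by apply/freq_moduleP; exists L.
  by exists (exist (fun x => x \in freq_module u) (L u) mL).
have forms (u : nat -> R) (m : freq_group u) : exists2 L, intform L & val m = L u.
  exact/freq_moduleP/(valP m).
have chi0 u L x : intform L -> L u = 0 -> int2pi (chi u L x).
  by move=> fL Lu; have /set_mem/hullP := valP x; exact.
apply: (@zmod_isomorphic_of_rel _ _ r).
- move=> m; have [L fL mL] := forms _ m.
  have [L' [u [fL' cu] uP]] := hull_character (contmod_comp cg (cchi w L fL)).
  by have [m' m'L'] := elt w' L' fL'; exists m', L, L', u; split.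
- move=> m'; have [L' fL' mL'] := forms _ m'.
  have [L [u [fL cu] uP]] := hull_character (contmod_comp cf (cchi w' L' fL')).
  have [m mL] := elt w L fL; exists m, L, L', (fun x => - u (g x)); split => //.
    have cug : continuous (u \o g).
      by move=> x; apply: continuous_comp; [exact: cg|exact: cu].
    by move=> x; exact: cvgN (cug x).
  move=> x; have := int2piN (uP (g x)); rewrite /= gf /chi; congr int2pi; ring.
- move=> m1 m1' m2 m2' [L1 [L1' [u1 [[fL1 m1L] [fL1' m1L'] cu1 u1P]]]].
  move=> [L2 [L2' [u2 [[fL2 m2L] [fL2' m2L'] cu2 u2P]]]].
  exists (fun z => L1 z - L2 z), (fun z => L1' z - L2' z), (fun x => u1 x - u2 x).
  split.
  + by split; [exact: intformB|rewrite -m1L -m2L].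
  + by split; [exact: intformB|rewrite -m1L' -m2L'].
  + by move=> x; exact: cvgB (cu1 x) (cu2 x).
  by move=> x; have := int2piB (u1P x) (u2P x); congr int2pi; rewrite /chi; ring.
- move=> m' [L [L' [u [[fL Lw] [fL' m'L'] cu uP]]]]; apply: val_inj.
  rewrite m'L'; apply: (@hull_character_unique _ w' L' (fun x => - u x)) => //.
    by move=> x; exact: cvgN (cu x).
  move=> x; have := int2piB (chi0 w L (g x) fL (esym Lw)) (uP x).
  by congr int2pi; rewrite /chi; ring.
move=> m [L [L' [u [[fL mL] [fL' L'w'] cu uP]]]]; apply: val_inj.
rewrite mL; apply: (@hull_character_unique _ w L (u \o f)) => //.
  by move=> x; apply: continuous_comp; [exact: cf|exact: cu].
move=> x; have := int2piD (uP (f x)) (chi0 w' L' (f x) fL' (esym L'w')).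
by rewrite fg; congr int2pi; rewrite /chi /=; ring.
Qed.

Theorem theoremD (R : realType) (w w' : nat -> R) :
  (forall theta theta' : inf_torus R,
     homeomorphic (set_type (closure (kronecker_orbit w theta)))
                  (set_type (closure (kronecker_orbit w' theta')))) <->
  zmod_isomorphic (freq_group w) (freq_group w').
Proof.
split=> [homeo|]; last exact: iso_homeomorphic.
by apply: homeomorphic_iso; exact: homeo.
Qed.
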